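(* Let $X$ be the embedded random walk of a stable $d$-dimensional Jackson network and let $Y$ be the associated limit process on $\Omega_Y=\mathbb{Z}\times\mathbb{Z}_+^{d-1}$ (both defined in the context). Fix $y\in\Omega_Y$ and set $x_n=T_n(y)=(n-y(1),y(2),\dots,y(d))$. Then $$\lim_{n\to\infty}P_{x_n}(\tau_n<\tau_0)=P_y(\tau<\infty).$$
   Context: Jackson network: $d$ nodes, external Poisson arrival rates $\lambda_i\ge 0$, exponential service rates $\mu_i>0$, routing probabilities $r_{ij}$ ($i,j\in\{1,\dots,d\}$) with exit probabilities $r_{i0}=1-\sum_{j}r_{ij}\ge0$, the matrix $(r_{ij})$ having spectral radius less than $1$; rates are normalized so that $\sum_i\lambda_i+\sum_i\mu_i=1$. The unconstrained increments $I_1,I_2,\dots$ of the embedded walk are i.i.d., equal to $e_i$ with probability $\lambda_i$, to $-e_i+e_j$ with probability $\mu_ir_{ij}$, and to $-e_i$ with probability $\mu_ir_{i0}$ ($e_i$ the standard basis vectors). Let $\nu$ be the solution of $\nu_i=\lambda_i+\sum_j\nu_jr_{ji}$; the network is stable if $\nu_i<\mu_i$ for all $i$. $X$ is the walk on $\mathbb{Z}_+^d$ with $X_{k+1}=X_k+\pi(X_k,I_k)$, where $\pi(x,v)=v$ if $x+v\in\mathbb{Z}_+^d$ and $0$ otherwise. $P_x$ refers to $X_0=x$. $\tau_n=\inf\{k:X_k(1)+\cdots+X_k(d)=n\}$ and $\tau_0=\inf\{k:X_k=0\}$. Let $\mathcal{I}_1$ be the $d\times d$ diagonal matrix with diagonal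 $(-1,1,\dots,1)$, $T_n(y)=ne_1+\mathcal{I}_1y$, and $J_k=\mathcal{I}_1I_k$. $Y$ is the walk on $\Omega_Y=\mathbb{Z}\times\mathbb{Z}_+^{d-1}$ with $Y_{k+1}=Y_k+\pi_1(Y_k,J_k)$, where $\pi_1(y,v)=v$ if $y+v\in\Omega_Y$ and $0$ otherwise. $\tau=\inf\{k:Y_k\in\partial B\}$ with $\partial B=\{y\in\Omega_Y:y(1)=\sum_{i=2}^dy(i)\}$; $P_y(\tau<\infty)$ refers to $Y_0=y$. ($T_n(y)\in\mathbb{Z}_+^d$ for $n\ge y(1)$.) *)

(* Defs.v *)
From HB Require Import structures.
From mathcomp Require Import all_boot all_order all_algebra.
From mathcomp Require Import finmap.
From mathcomp Require Import complex.
From mathcomp Require Import all_classical all_reals all_analysis.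

Set Implicit Arguments.
Unset Strict Implicit.
Unset Printing Implicit Defensive.
Import Order.TTheory GRing.Theory Num.Theory.

Local Open Scope classical_set_scope.
Local Open Scope ring_scope.

Definition spectral_radius (R : realType) (d : nat) (A : 'M[R]_d) : R :=
  sup [set complex.Re `|z| | z in
        [set z : complex R | eigenvalue (map_mx (real_complex R) A) z]].

Record jackson_network (R : realType) (d : nat) := JacksonNetwork {
  arrival : 'I_d -> R;
  service : 'I_d -> R;
  routing : 'M[R]_d;
  arrival_ge0 : forall i, 0 <= arrival i;
  service_gt0 : forall i, 0 < service i;
  routing_ge0 : forall i j, 0 <= routing i j;
  exit_ge0 : forall i, 0 <= 1 - \sum_j routing i j;
  routing_spectral_radius : spectral_radius routing < 1;
  rates_normalized : \sum_i arrival i + \sum_i service i = 1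
}.

Definition exit_prob (R : realType) (d : nat) (N : jackson_network R d)
  (i : 'I_d) : R := 1 - \sum_j routing N i j.

Definition traffic_solution (R : realType) (d : nat) (N : jackson_network R d)
  (nu : 'I_d -> R) : Prop :=
  forall i, nu i = arrival N i + \sum_j nu j * routing N j i.

Definition basis_vec (d : nat) (i : 'I_d) : 'cV[int]_d := delta_mx i 0.

(* Distinct transitions can produce the same vector (every self-routing
   i -> i yields 0), so the mass at [v] is a sum over all transitions. *)
Definition increment_law (R : realType) (d : nat) (N : jackson_network R d)
  (v : 'cV[int]_d) : R :=
  \sum_i arrival N i * (v == basis_vec i)%:R
  + \sum_i \sum_j service N i * routing N i j
                  * (v == - basis_vec i + basis_vec j)%:R
  + \sum_i service N i * exit_prob N i * (v == - basis_vec i)%:R.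

Definition mutually_independent (R : realType) (disp : measure_display)
  (T : measurableType disp) (P : probability T R) (V : Type)
  (I : nat -> T -> V) : Prop :=
  forall (K : {fset nat}) (A : nat -> set V),
    P (\bigcap_(k in [set` K]) (I k @^-1` A k))
    = (\prod_(k <- K) P (I k @^-1` A k))%E.

(* The value space is countable and carries the discrete sigma-algebra.  The
   sequence is indexed from 0: [I k] is the increment I_(k+1). *)
Definition iid_increments (R : realType) (d : nat) (N : jackson_network R d)
  (disp : measure_display) (T : measurableType disp) (P : probability T R)
  (I : nat -> T -> 'cV[int]_d) : Prop :=
  [/\ forall k (A : set 'cV[int]_d), measurable (I k @^-1` A),
      mutually_independent P I
    & forall k v, P (I k @^-1` [set v]) = (increment_law N v)%:E].

Definition constrain (d : nat) (S : pred 'cV[int]_d) (x v : 'cV[int]_d) :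
  'cV[int]_d := if S (x + v) then v else 0.

Fixpoint walk (d : nat) (S : pred 'cV[int]_d) (x : 'cV[int]_d)
  (I : nat -> 'cV[int]_d) (k : nat) : 'cV[int]_d :=
  if k is j.+1 then walk S x I j + constrain S (walk S x I j) (I j) else x.

(* [+oo] when the set is never visited, as [ereal_inf set0 = +oo]. *)
Definition hitting_time (R : realType) (V : Type) (A : set V) (x : nat -> V) :
  \bar R := ereal_inf [set k%:R%:E | k in [set k : nat | A (x k)]].

Definition orthant (d : nat) : pred 'cV[int]_d :=
  fun x => [forall i, 0 <= x i 0].

(* The first coordinate is singled out, so the dimension is d.+1 and the first
   node is [ord0]. *)
Definition OmegaY (d : nat) : pred 'cV[int]_d.+1 :=
  fun y => [forall i, (i != ord0) ==> (0 <= y i 0)].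

Definition reflect1 (d : nat) : 'M[int]_d.+1 :=
  diag_mx (\row_i if i == ord0 then -1 else 1).

Definition shift_map (d : nat) (n : nat) (y : 'cV[int]_d.+1) : 'cV[int]_d.+1 :=
  basis_vec ord0 *+ n + reflect1 d *m y.

Definition level_set (d : nat) (n : nat) : set 'cV[int]_d :=
  [set x | \sum_i x i 0 = n%:Z].

Definition boundaryB (d : nat) : set 'cV[int]_d.+1 :=
  [set y | OmegaY y /\ y ord0 0 = \sum_(i | i != ord0) y i 0].

Definition walkX (d : nat) (x : 'cV[int]_d) (I : nat -> 'cV[int]_d) :
  nat -> 'cV[int]_d := walk (@orthant d) x I.

Definition walkY (d : nat) (y : 'cV[int]_d.+1) (I : nat -> 'cV[int]_d.+1) :
  nat -> 'cV[int]_d.+1 := walk (@OmegaY d) y (fun k => reflect1 d *m I k).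

(* P_x(tau_n < tau_0); P_x is realized by starting the path at [x]. *)
Definition prob_overflow (R : realType) (d : nat) (disp : measure_display)
  (T : measurableType disp) (P : probability T R)
  (I : nat -> T -> 'cV[int]_d) (n : nat) (x : 'cV[int]_d) : \bar R :=
  P [set w | (hitting_time R (level_set n) (walkX x (fun k => I k w))
              < hitting_time R [set 0%R] (walkX x (fun k => I k w)))%E].

(* P_y(tau < oo) *)
Definition prob_hitB (R : realType) (d : nat) (disp : measure_display)
  (T : measurableType disp) (P : probability T R)
  (I : nat -> T -> 'cV[int]_d.+1) (y : 'cV[int]_d.+1) : \bar R :=
  P [set w | (hitting_time R (@boundaryB d) (walkY y (fun k => I k w))
              < +oo)%E].

(* Main.v *)
Require Import Defs.
From HB Require Import structures.
From mathcomp Require Import all_boot all_order all_algebra.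
From mathcomp Require Import finmap complex zify ring lra.
From mathcomp Require Import all_classical all_reals all_analysis.

Set Implicit Arguments.
Unset Strict Implicit.
Unset Printing Implicit Defensive.
Import Order.TTheory GRing.Theory Num.Theory.

Local Open Scope classical_set_scope.
Local Open Scope ring_scope.

(** Both processes are driven by the same increments.  In the coordinates given by
    [shift_map n], the limit process is the network walk without the constraint
    at the first node (the free walk), and reaching the boundary means having [n]
    customers.  The first queue starts with [n - y 1] customers, and up to that
    time the two walks agree.  Hence every event decided by a fixed time is
    eventually the same for both, which gives the lower bound
    ([hitsB_le_overflow]).

    The converse has to exclude an overflow that happens after time [n - y 1] and
    before the origin is visited ([overflow_le_hitsB]).  Run next to the network
    walk [X] the walk [Z] from the empty state, with the same increments.  By
    [run_coupling], [X >= Z] at all times and the total of the surplus [X - Z],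
    which is less than [n] at first, never increases.  It is therefore enough
    that the surplus has lost a positive fraction of [n] by time [n - y 1], and
    that from then on [Z] stays below that fraction until [X] is empty.

    - [Z] is small.  Jackson's product form is an invariant measure that dominates
      the point mass at the empty state, so it dominates the law of [Z] at every
      time ([run0_law_le]); stability makes it summable, and the total of [Z]
      exceeds [L] with probability at most [C r ^ L], uniformly in time
      ([run0_tail]).  A union bound covers a horizon linear in [n].
    - The surplus decreases linearly.  As the spectral radius is less than 1, the
      exit can be reached from every node, and some fixed word of increments
      empties [Z] from any state of total at most [L] and removes a customer of
      the surplus on top of that ([flush_word]).  Cut time into blocks of the
      length of this word.  For most blocks [Z] is low at the beginning, and then
      the block equals the word with a fixed probability; a second moment bound
      for the resulting martingale shows that a positive fraction of the blocks
      flush ([flush_rate]).  After more flushes than initial customers, [X] has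
      visited the origin ([run_flushed]).

    If [y] lies on the boundary or beyond it, then both probabilities tend to 1:
    the free walk never has a larger total than the network, which reaches the
    origin, and the total does not skip the level [n] ([prob_hitsB_beyond]). *)

(** * Substochastic routing without closed classes *)

(** Summing the moduli of the coordinates of a left eigenvector shows it. *)
Lemma eigenvalue_substochastic (R : realType) (d : nat) (A : 'M[R]_d)
  (z : complex R) :
  (forall i j, 0 <= A i j) -> (forall i, \sum_j A i j <= 1) ->
  eigenvalue (map_mx (real_complex R) A) z -> `|z| <= 1.
Proof.
move=> A0 A1 /eigenvalueP[v vA v0].
have v_ge0 j : true -> 0 <= `|v 0 j| by [].
have v_gt0 : 0 < \sum_j `|v 0 j|.
  rewrite lt_neqAle (sumr_ge0 _ v_ge0) andbT eq_sym.
  apply: contra v0; rewrite (psumr_eq0 _ v_ge0) => /allP v0.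
  apply/eqP/rowP => j; rewrite mxE.
  by apply/eqP; rewrite -normr_eq0; apply: v0; rewrite mem_index_enum.
rewrite -(ler_pM2r v_gt0) mul1r mulr_sumr.
under eq_bigr => j _ do rewrite -normrM.
have E j : z * v 0 j = \sum_i v 0 i * (A i j)%:C%C.
  have := congr1 (fun M : 'rV_d => M 0 j) vA; rewrite !mxE => <-.
  by apply: eq_bigr => i _; rewrite !mxE.
apply: (@le_trans _ _ (\sum_j \sum_i `|v 0 i| * (A i j)%:C%C)).
  apply: ler_sum => j _; rewrite E (le_trans (ler_norm_sum _ _ _))//.
  apply: ler_sum => i _; rewrite normrM ler_wpM2l//.
  by rewrite ger0_norm// lecR.
rewrite exchange_big/=; apply: ler_sum => i _.
rewrite -mulr_sumr -rmorph_sum/= -[leRHS]mulr1 ler_wpM2l//.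
by rewrite lecR.
Qed.

Section Network.
Context (R : realType) (d : nat) (N : jackson_network R d.+1).

Lemma routing_row_le1 i : \sum_j routing N i j <= 1.
Proof. by rewrite -subr_ge0 exit_ge0. Qed.

(** Otherwise 1 would be an eigenvalue; the eigenvalues of a substochastic
    matrix are bounded, so the supremum defining the spectral radius would be
    at least 1. *)
Lemma one_minus_routing_unit : 1%:M - routing N \in unitmx.
Proof.
apply: contraT => notu.
have ev : eigenvalue (map_mx (real_complex R) (routing N)) 1.
  rewrite -(rmorph1 (real_complex R)) eigenvalue_map eigenvalue_root_char.
  rewrite /root /char_poly -horner_evalE -det_map_mx.
  rewrite unitmxE unitfE negbK in notu.
  have -> // : map_mx (horner_eval 1) (char_poly_mx (routing N)) =
          1%:M - routing N.
  apply/matrixP => i j; rewrite !mxE /horner_eval.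
  by case: (i == j); rewrite ?mulr1n ?mulr0n !hornerE.
suff : 1 <= spectral_radius (routing N) by rewrite leNgt routing_spectral_radius.
rewrite /spectral_radius; apply: ub_le_sup.
  exists 1 => _ [z zev <-].
  have := eigenvalue_substochastic (routing_ge0 N) routing_row_le1 zev.
  by rewrite lecE/= => /andP[].
by exists 1 => //; rewrite normr1.
Qed.

(** At a node where the solution [w] of [w = 1 + routing w] is least over the
    set, this equation would give [min w >= 1 + min w]. *)
Lemma no_closed_set (C : {set 'I_d.+1}) (i0 : 'I_d.+1) : i0 \in C ->
  (forall i, i \in C -> 1 <= \sum_(j in C) routing N i j) -> False.
Proof.
move=> i0C closedC.
pose w : 'cV[R]_d.+1 := invmx (1%:M - routing N) *m const_mx 1.
have wE i : w i 0 = 1 + \sum_j routing N i j * w j 0.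
  have : (1%:M - routing N) *m w = const_mx 1.
    by rewrite mulmxA mulmxV ?mul1mx// one_minus_routing_unit.
  move=> /(congr1 (fun M : 'cV_d.+1 => M i 0)).
  rewrite mulmxBl mul1mx !mxE => /eqP; rewrite subr_eq => /eqP ->.
  by [].
have [i iC imin] := arg_minP (fun i => w i 0) i0C.
have in0 j : j \notin C -> routing N i j = 0.
  move=> jC; apply/eqP; rewrite eq_le routing_ge0 andbT.
  have := le_trans (routing_row_le1 i) (closedC _ iC).
  rewrite (bigID (mem C))/= gerDl.
  apply: le_trans; rewrite (bigD1 j)//= lerDl sumr_ge0// => *.
  exact: routing_ge0.
have : w i 0 >= 1 + w i 0.
  rewrite {2}wE lerD2l.
  rewrite (bigID (mem C))/= [X in _ <= _ + X]big1 ?addr0; last first.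
    by move=> j /in0 ->; rewrite mul0r.
  apply: (@le_trans _ _ (\sum_(j in C) routing N i j * w i 0)).
    rewrite -mulr_suml.
    have -> : \sum_(j in C) routing N i j = 1; last by rewrite mul1r.
    apply/eqP; rewrite eq_le closedC// andbT.
    apply: le_trans (routing_row_le1 i).
    rewrite [leRHS](bigID (mem C))/= lerDl sumr_ge0// => *.
    exact: routing_ge0.
  by apply: ler_sum => j jC; rewrite ler_wpM2l ?routing_ge0// imin.
by rewrite gerDr ler10.
Qed.

(** The traffic equation, summed over the nodes with a negative solution, would
    make them a closed set. *)
Lemma traffic_solution_ge0 (nu : 'I_d.+1 -> R) : traffic_solution N nu ->
  forall i, 0 <= nu i.
Proof.
move=> hnu i0; rewrite leNgt; apply/negP => i0lt.
pose C := [set i | nu i < 0]%SET.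
apply: (@no_closed_set C i0); first by rewrite inE.
have sub1 j : \sum_(i in C) routing N j i <= 1.
  apply: le_trans (routing_row_le1 j); rewrite [leRHS](bigID (mem C))/=.
  by rewrite lerDl sumr_ge0// => *; exact: routing_ge0.
have le1 : \sum_(j in C) nu j * (\sum_(i in C) routing N j i)
    <= \sum_(i in C) nu i.
  rewrite [leRHS](_ : _ = \sum_(i in C) arrival N i +
                     \sum_j nu j * \sum_(i in C) routing N j i); last first.
    under [X in _ = _ + X]eq_bigr => j _ do rewrite mulr_sumr.
    rewrite [X in _ + X]exchange_big -big_split/=.
    by apply: eq_bigr => i _; exact: hnu.
  rewrite [X in _ + X](bigID (mem C))/= addrCA lerDl addr_ge0//.
    by apply: sumr_ge0 => *; exact: arrival_ge0.
  apply: sumr_ge0 => j; rewrite inE -leNgt => jC.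
  by rewrite mulr_ge0// sumr_ge0// => *; exact: routing_ge0.
have ge0 j : j \in C -> 0 <= nu j * (\sum_(i in C) routing N j i - 1).
  rewrite inE => jC; rewrite mulr_le0 ?subr_le0//; exact: ltW.
move=> i iC; rewrite -subr_ge0.
have iC' := iC; rewrite inE in iC'.
rewrite -(ler_nM2l iC') mulr0.
have : \sum_(j in C) nu j * (\sum_(i in C) routing N j i - 1) <= 0.
  under eq_bigr => j _ do rewrite mulrBr mulr1.
  by rewrite sumrB subr_le0.
apply: le_trans; rewrite [leRHS](bigD1 i)//= lerDl.
by apply: sumr_ge0 => j /andP[jC _]; exact: ge0.
Qed.
End Network.

(** * Constrained walks and their monotone coupling *)

Section Dynamics.
Variable d : nat.
Implicit Types (x y v : 'cV[int]_d) (J : pred 'I_d).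

Lemma cvD x y i : (x + y) i 0 = x i 0 + y i 0.
Proof. by rewrite mxE. Qed.

Lemma cvN x i : (- x) i 0 = - x i 0.
Proof. by rewrite mxE. Qed.

Definition tot x : int := \sum_i x i 0.

Lemma totD x y : tot (x + y) = tot x + tot y.
Proof. by rewrite /tot -big_split; apply: eq_bigr => i _; rewrite mxE. Qed.

Lemma totN x : tot (- x) = - tot x.
Proof. by rewrite /tot -sumrN; apply: eq_bigr => i _; rewrite mxE. Qed.

Lemma totB x y : tot (x - y) = tot x - tot y.
Proof. by rewrite totD totN. Qed.

Lemma tot0 : tot 0 = 0.
Proof. by rewrite /tot big1// => i _; rewrite mxE. Qed.

Lemma basis_vecE (i k : 'I_d) : basis_vec i k 0 = (k == i)%:R.
Proof. by rewrite mxE eqxx andbT. Qed.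

Lemma tot_basis_vec i : tot (basis_vec i) = 1.
Proof.
rewrite /tot (bigD1 i)//= basis_vecE eqxx big1 ?addr0// => k /negPf ki.
by rewrite basis_vecE ki.
Qed.

Definition cset J : pred 'cV[int]_d :=
  fun x => [forall i, J i ==> (0 <= x i 0)].

Lemma csetP J x : reflect (forall i, J i -> 0 <= x i 0) (cset J x).
Proof.
by apply: (iffP forallP) => h i; [apply/implyP: (h i)|apply/implyP/h].
Qed.

Definition increments : seq 'cV[int]_d :=
  [seq basis_vec i | i <- enum 'I_d]
  ++ [seq - basis_vec i + basis_vec j | i <- enum 'I_d, j <- enum 'I_d]
  ++ [seq - basis_vec i | i <- enum 'I_d].

Lemma incrementsP v : reflect
  [\/ exists i, v = basis_vec i, exists i j, v = - basis_vec i + basis_vec j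
    | exists i, v = - basis_vec i] (v \in increments).
Proof.
rewrite !mem_cat; apply: (iffP or3P) => -[].
- by move=> /mapP[i _ ->]; constructor 1; exists i.
- by move=> /allpairsP[[i j] [_ _ ->]]; constructor 2; exists i, j.
- by move=> /mapP[i _ ->]; constructor 3; exists i.
- by move=> [i ->]; constructor 1; apply/mapP; exists i; rewrite ?mem_enum.
- move=> [i [j ->]]; constructor 2; apply/allpairsP.
  by exists (i, j); rewrite !mem_enum.
- by move=> [i ->]; constructor 3; apply/mapP; exists i; rewrite ?mem_enum.
Qed.

(** Self-routing gives the zero vector, which is why the two cases below are
    not those of arrivals and services. *)
Lemma increment_shape v : v \in increments ->
  (forall k, 0 <= v k 0) \/
  exists i, [/\ v i 0 = -1, forall k, k != i -> 0 <= v k 0 & tot v <= 0].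
Proof.
move=> /incrementsP[[i ->]|[i [j ->]]|[i ->]].
- by left=> k; rewrite basis_vecE; case: eqP.
- have [->|ij] := eqVneq i j; first by left=> k; rewrite addNr mxE.
  right; exists i; split.
  + by rewrite cvD cvN !basis_vecE eqxx (negPf ij).
  + by move=> k /negPf ki; rewrite cvD cvN !basis_vecE ki; case: eqP.
  + by rewrite totD totN !tot_basis_vec.
- right; exists i; split.
  + by rewrite cvN basis_vecE eqxx.
  + by move=> k /negPf ki; rewrite cvN basis_vecE ki.
  + by rewrite totN tot_basis_vec.
Qed.

Lemma tot_increment v : v \in increments -> -1 <= tot v <= 1.
Proof.
by move=> /incrementsP[[i ->]|[i [j ->]]|[i ->]];
  rewrite ?totD ?totN !tot_basis_vec.
Qed.

Lemma increment_geN1 v k : v \in increments -> -1 <= v k 0.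
Proof.
move=> /increment_shape[/(_ k)|[i [vi vk _]]]; first by lia.
by have [->|/vk] := eqVneq k i; lia.
Qed.

Lemma step_cset J x v : cset J x -> cset J (x + constrain (cset J) x v).
Proof. by rewrite /constrain; case: ifPn => //; rewrite addr0. Qed.

(** An increment blocked for the more constrained walk [x] at a node where [x']
    may still move is a service there, so it only lowers the total of
    [x' - x]; the reverse situation cannot occur. *)
Lemma step_coupling J J' x x' v : (forall i, J' i -> J i) ->
  v \in increments -> cset J x -> cset J' (x' - x) ->
  let z := x + constrain (cset J) x v in
  let z' := x' + constrain (cset J') x' v in
  cset J' (z' - z) /\ tot (z' - z) <= tot (x' - x).
Proof.
move=> JJ' vI /csetP xJ /csetP xx' /=.
have xx'i i : J' i -> x i 0 <= x' i 0.
  by move=> /xx'; rewrite cvD cvN subr_ge0.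
(* both walks move, or both are blocked ([w = 0]) *)
have same w : cset J' (x' + w - (x + w)) /\
    tot (x' + w - (x + w)) <= tot (x' - x).
  by rewrite [x + w]addrC addrKA; split => //; apply/csetP.
have x'J i : J' i -> 0 <= x' i 0.
  by move=> iJ'; apply: le_trans (xx'i _ iJ'); exact/xJ/JJ'.
rewrite /constrain; case: (increment_shape vI) => [v0|[i [vi vk vt]]].
  have vJ (K : pred 'I_d) z : cset K z -> cset K (z + v).
    by move=> /csetP zK; apply/csetP => i Ki; rewrite cvD addr_ge0// zK.
  by rewrite !vJ; [exact: same|exact/csetP|exact/csetP].
(* [v] can only be blocked at the node [i] that it serves *)
have moveE (K : pred 'I_d) z : cset K z ->
    cset K (z + v) = (K i ==> (1 <= z i 0)).
  move=> /csetP zK; apply/csetP/implyP => [h Ki|h k Kk].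
    by have := h i Ki; rewrite cvD vi; lia.
  rewrite cvD; have [ki|ki] := eqVneq k i.
    by move: Kk; rewrite ki vi => /h; lia.
  by have := vk _ ki; have := zK _ Kk; lia.
rewrite !moveE; [|exact/csetP|exact/csetP].
case: (boolP (J i ==> _)) => [hx|]; case: (boolP (J' i ==> _)) => [hx'|].
- exact: same.
- rewrite negb_imply => /andP[J'i]; have := xx'i _ J'i.
  by move: hx; rewrite (JJ' _ J'i)/=; lia.
- rewrite negb_imply => /andP[Ji xi]; rewrite addr0; split; last first.
    by rewrite !totB totD; lia.
  apply/csetP => k J'k; rewrite cvD cvD cvN.
  have [ki|ki] := eqVneq k i.
    move: hx' J'k (xJ _ Ji); rewrite ki vi => /implyP h /h; lia.
  by have := vk _ ki; have := xx'i _ J'k; lia.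
- by move=> _ _; exact: same.
Qed.

(** The walk along a finite list of increments; lists, unlike sequences of
    times, can be cut into blocks. *)
Definition run (S : pred 'cV[int]_d) x (s : seq 'cV[int]_d) : 'cV[int]_d :=
  foldl (fun z v => z + constrain S z v) x s.

Lemma run_cat S x s1 s2 : run S x (s1 ++ s2) = run S (run S x s1) s2.
Proof. exact: foldl_cat. Qed.

Lemma walk_run S x (J : nat -> 'cV[int]_d) k :
  walk S x J k = run S x (mkseq J k).
Proof. by elim: k => // k ih; rewrite mkseqS -cats1 run_cat -ih. Qed.

Lemma run_cset J x s : cset J x -> cset J (run (cset J) x s).
Proof. by elim: s x => //= v s ih x /(step_cset v)/ih. Qed.

(** With [J = J'] this is the monotonicity of the network in its initial state,
    together with the fact that the surplus customers of the larger walk can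
    only leave.  With [J'] smaller it compares the network with the one whose
    server never idles at the nodes outside of [J']. *)
Lemma run_coupling J J' x x' s : (forall i, J' i -> J i) ->
  {subset s <= increments} -> cset J x -> cset J' (x' - x) ->
  cset J' (run (cset J') x' s - run (cset J) x s) /\
  tot (run (cset J') x' s - run (cset J) x s) <= tot (x' - x).
Proof.
move=> JJ'; elim: s x x' => //= v s ih x x' sI xJ xx'.
have vI : v \in increments by apply: sI; rewrite mem_head.
have [h1 h2] := step_coupling JJ' vI xJ xx'.
have sI' : {subset s <= increments}.
  by move=> u us; apply: sI; rewrite inE us orbT.
have [h3 h4] := ih _ _ sI' (step_cset v xJ) h1.
by split => //; apply: le_trans h4 h2.
Qed.

Lemma step_tot S x v : v \in increments ->
  tot x - 1 <= tot (x + constrain S x v) <= tot x + 1.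
Proof.
move=> /tot_increment; rewrite /constrain; case: ifP => _.
  by rewrite totD; lia.
by rewrite addr0; lia.
Qed.

End Dynamics.

(** * Words of increments that flush customers out *)

Section Law.
Context (R : realType) (d : nat) (N : jackson_network R d.+1).
Implicit Types (g h : 'cV[int]_d.+1 -> R).

(** Expectation over one increment, as a sum over the transitions rather than
    over the vectors, since different transitions can give the same vector. *)
Definition Estep g : R :=
  \sum_i arrival N i * g (basis_vec i)
  + \sum_i \sum_j service N i * routing N i j * g (- basis_vec i + basis_vec j)
  + \sum_i service N i * exit_prob N i * g (- basis_vec i).

Lemma increment_lawE v : increment_law N v = Estep (fun u => (v == u)%:R).
Proof. by []. Qed.

Lemma service_ge0 i : 0 <= service N i.
Proof. exact/ltW/service_gt0. Qed.

Lemma exit_prob_ge0 i : 0 <= exit_prob N i.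
Proof. exact: exit_ge0. Qed.

Lemma Estep_le g h : {in @increments d.+1, forall v, g v <= h v} ->
  Estep g <= Estep h.
Proof.
move=> gh; rewrite /Estep !lerD//; apply: ler_sum => i _.
- rewrite ler_wpM2l ?arrival_ge0// gh//.
  by apply/incrementsP; constructor 1; exists i.
- apply: ler_sum => j _.
  rewrite ler_wpM2l ?mulr_ge0 ?service_ge0 ?routing_ge0// gh//.
  by apply/incrementsP; constructor 2; exists i, j.
- rewrite ler_wpM2l ?mulr_ge0 ?service_ge0 ?exit_prob_ge0// gh//.
  by apply/incrementsP; constructor 3; exists i.
Qed.

Lemma EstepD g h : Estep (fun v => g v + h v) = Estep g + Estep h.
Proof.
rewrite /Estep; under eq_bigr do rewrite mulrDr.
under [X in _ + X + _]eq_bigr do under eq_bigr do rewrite mulrDr.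
under [X in _ + _ + X]eq_bigr do rewrite mulrDr.
under [X in _ + X + _]eq_bigr do rewrite big_split/=.
by rewrite !big_split/=; ring.
Qed.

Lemma EstepZ c g : Estep (fun v => c * g v) = c * Estep g.
Proof.
rewrite /Estep !mulrDr !mulr_sumr; congr (_ + _ + _); apply: eq_bigr => i _.
- by rewrite mulrCA.
- by rewrite mulr_sumr; apply: eq_bigr => j _; rewrite mulrCA.
- by rewrite mulrCA.
Qed.

Lemma Estep1 : Estep (fun => 1) = 1.
Proof.
rewrite /Estep -addrA -big_split/= -[RHS](rates_normalized N); congr (_ + _).
  by apply: eq_bigr => i _; rewrite mulr1.
apply: eq_bigr => i _; rewrite mulr1.
under eq_bigr => j _ do rewrite mulr1.
by rewrite -mulr_sumr /exit_prob; ring.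
Qed.

Lemma Estep_cst c : Estep (fun => c) = c.
Proof.
have E : Estep (fun => c * 1) = c by rewrite EstepZ Estep1 mulr1.
by rewrite -[RHS]E mulr1.
Qed.

Lemma Estep_ge0 g : (forall v, 0 <= g v) -> 0 <= Estep g.
Proof. by move=> g0; rewrite -(Estep_cst 0); apply: Estep_le. Qed.

Lemma Estep_sum (T : Type) (r : seq T) (F : T -> 'cV[int]_d.+1 -> R) :
  Estep (fun v => \sum_(t <- r) F t v) = \sum_(t <- r) Estep (F t).
Proof.
elim: r => [|t r ih].
  by rewrite big_nil -[RHS]Estep_cst; under eq_fun do rewrite big_nil.
by rewrite big_cons -ih -EstepD; under eq_fun do rewrite big_cons.
Qed.

Lemma increment_law_ge0 v : 0 <= increment_law N v.
Proof. by rewrite increment_lawE Estep_ge0// => u; case: eqP. Qed.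

Lemma service_exit_law_gt0 i : 0 < exit_prob N i ->
  0 < increment_law N (- basis_vec i).
Proof.
move=> e0; rewrite /increment_law ltr_wpDl//.
  rewrite addr_ge0//; apply: sumr_ge0 => k _.
    by rewrite mulr_ge0 ?arrival_ge0.
  by apply: sumr_ge0 => j _; rewrite !mulr_ge0 ?service_ge0 ?routing_ge0.
rewrite (bigD1 i)//= eqxx mulr1 ltr_pwDl ?mulr_gt0 ?service_gt0//.
by apply: sumr_ge0 => k _; rewrite !mulr_ge0 ?service_ge0 ?exit_prob_ge0.
Qed.

Lemma service_route_law_gt0 i j : 0 < routing N i j ->
  0 < increment_law N (- basis_vec i + basis_vec j).
Proof.
move=> r0; rewrite /increment_law ltr_pwDl//; last first.
  by apply: sumr_ge0 => k _; rewrite !mulr_ge0 ?service_ge0 ?exit_prob_ge0.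
rewrite ltr_wpDl//.
  by apply: sumr_ge0 => k _; rewrite mulr_ge0 ?arrival_ge0.
rewrite (bigD1 i)//= ltr_pwDl//; last first.
  apply: sumr_ge0 => k _; apply: sumr_ge0 => l _.
  by rewrite !mulr_ge0 ?service_ge0 ?routing_ge0.
rewrite (bigD1 j)//= eqxx mulr1 ltr_pwDl ?mulr_gt0 ?service_gt0//.
by apply: sumr_ge0 => l _; rewrite !mulr_ge0 ?service_ge0 ?routing_ge0.
Qed.

End Law.

Local Notation orth := (@cset _ xpredT).

Section Drain.
Context (R : realType) (d : nat) (N : jackson_network R d.+1).
Implicit Types (x z : 'cV[int]_d.+1) (w : seq 'cV[int]_d.+1).

Lemma orthP x : reflect (forall i, 0 <= x i 0) (orth x).
Proof. by apply: (iffP (csetP _ _)) => h i; [exact: h|move=> _; exact: h]. Qed.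

Lemma orth0 : orth (0 : 'cV[int]_d.+1).
Proof. by apply/orthP => i; rewrite mxE. Qed.

Lemma tot_ge0 x : orth x -> 0 <= tot x.
Proof. by move=> /orthP x0; apply: sumr_ge0. Qed.

Lemma tot_eq0 x : orth x -> tot x <= 0 -> x = 0.
Proof.
move=> /orthP x0 t0; apply/matrixP => i j; rewrite ord1 mxE.
apply: le_anti; rewrite x0 andbT; apply: le_trans t0.
by rewrite /tot (bigD1 i)//= lerDl; apply: sumr_ge0.
Qed.

(** The services that take one customer from a node out of the network, along a
    route of positive probability. *)
Inductive drain : 'I_d.+1 -> seq 'cV[int]_d.+1 -> Prop :=
| drain_exit i : 0 < exit_prob N i -> drain i [:: - basis_vec i]
| drain_route i j w : 0 < routing N i j -> drain j w ->
    drain i ((- basis_vec i + basis_vec j) :: w).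

(** The nodes from which no exit can be reached would form a closed set. *)
Lemma drain_exists i : exists w, drain i w.
Proof.
apply: contrapT => nw.
pose C := [set j | `[< ~ exists w, drain j w >]]%SET.
apply: (@no_closed_set _ _ N C i); first by rewrite inE; exact/asboolP.
move=> j; rewrite inE => /asboolP jC.
have e0 : exit_prob N j = 0.
  apply/eqP; rewrite eq_le exit_prob_ge0 andbT leNgt; apply/negP => ej.
  by apply: jC; exists [:: - basis_vec j]; constructor.
move/eqP : e0; rewrite /exit_prob subr_eq0 => /eqP {1}->.
rewrite (bigID (mem C))/= [X in _ + X]big1 ?addr0// => k.
rewrite inE => kC; apply/eqP; rewrite eq_le routing_ge0 andbT leNgt.
apply/negP => rjk; move/asboolPn : kC => /contrapT[w kw].
by apply: jC; exists ((- basis_vec j + basis_vec k) :: w); constructor.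
Qed.

Lemma drain_law i w : drain i w -> all (fun v => 0 < increment_law N v) w.
Proof.
elim => {i w} [i e0|i j w r0 _ ih] /=.
  by rewrite service_exit_law_gt0.
by rewrite ih service_route_law_gt0.
Qed.

Lemma drain_increments i w : drain i w -> {subset w <= @increments d.+1}.
Proof.
elim => {i w} [i _|i j w _ _ ih] v; rewrite inE.
  by move=> /eqP ->; apply/incrementsP; constructor 3; exists i.
by move=> /orP[/eqP ->|/ih//]; apply/incrementsP; constructor 2; exists i, j.
Qed.

Lemma step_exit x i : orth x ->
  x + constrain orth x (- basis_vec i) =
  if 1 <= x i 0 then x - basis_vec i else x.
Proof.
move=> /orthP x0; rewrite /constrain; case: ifPn => [/orthP h|/orthP h].
  case: ifPn => //; have := h i; rewrite cvD cvN basis_vecE eqxx/=.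
  by rewrite subr_ge0 => ->.
rewrite addr0; case: ifPn => // xi; exfalso; apply: h => k.
rewrite cvD cvN basis_vecE; have [->|_] := eqVneq; first by rewrite subr_ge0.
by rewrite subr0.
Qed.

Lemma step_route x i j : orth x ->
  x + constrain orth x (- basis_vec i + basis_vec j) =
  if 1 <= x i 0 then x - basis_vec i + basis_vec j else x.
Proof.
move=> xO; have /orthP x0 := xO; have [<-|ij] := eqVneq i j.
  by rewrite addNr subrK /constrain !if_same addr0.
rewrite /constrain addrA; case: ifPn => [/orthP h|/orthP h].
  case: ifPn; first by rewrite addrA.
  have := h i; rewrite !cvD cvN !basis_vecE eqxx (negPf ij)/=.
  by rewrite addr0 subr_ge0 => ->.
rewrite addr0; case: ifPn => // xi; exfalso; apply: h => k.
rewrite !cvD cvN !basis_vecE; have [->|_] := eqVneq k i.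
  by rewrite (negPf ij) addr0 subr_ge0.
by rewrite subr0 addr_ge0.
Qed.

Lemma run_drain_exit i w x : drain i w -> orth x -> 1 <= x i 0 ->
  tot (run orth x w) <= tot x - 1.
Proof.
move=> iw; elim: iw x => {i w} [i _|i j w _ _ ih] x xO xi /=.
  by rewrite step_exit// xi totB tot_basis_vec.
have yO := step_cset (- basis_vec i + basis_vec j) xO.
rewrite step_route// xi in yO *.
apply: (le_trans (ih _ yO _)); last by rewrite totD totB !tot_basis_vec subrK.
rewrite !cvD cvN !basis_vecE eqxx; have [->|_] := eqVneq j i; first lia.
by have /orthP/(_ j) := xO; lia.
Qed.

(** A customer who moves along the word keeps being the one who is served next,
    so a word that moves anybody at all ends with a departure. *)
Lemma run_drain i w x : drain i w -> orth x ->
  run orth x w = x \/ tot (run orth x w) <= tot x - 1.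
Proof.
move=> iw; elim: (iw) x => {i w iw} [i e0|i j w r0 jw ih] x xO.
  have [xi|xi] := boolP (1 <= x i 0).
    by right; apply: run_drain_exit xO xi; constructor.
  by left; rewrite /= step_exit// (negPf xi).
have [xi|xi] := boolP (1 <= x i 0).
  by right; apply: run_drain_exit xO xi; constructor.
by rewrite /= step_route// (negPf xi); exact: ih.
Qed.

Definition charged w :=
  all (fun v => 0 < increment_law N v) w /\ {subset w <= @increments d.+1}.

Lemma charged_cat w1 w2 : charged w1 -> charged w2 -> charged (w1 ++ w2).
Proof.
move=> [l1 i1] [l2 i2]; split; first by rewrite all_cat l1.
by move=> v; rewrite mem_cat => /orP[/i1|/i2].
Qed.

(** The concatenation of one draining word for each node: the first of these
    words that moves anybody makes a customer leave, and if none did so before,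
    the word of an occupied node does. *)
Lemma flush_one : exists U, [/\ charged U,
  forall x, orth x -> x != 0 -> tot (run orth x U) <= tot x - 1
  & run orth 0 U = 0].
Proof.
have [U [Uc UP]] : exists U, charged U /\
    forall x, orth x -> (run orth x U = x \/ tot (run orth x U) <= tot x - 1) /\
      forall i, i \in enum 'I_d.+1 -> 1 <= x i 0 ->
        tot (run orth x U) <= tot x - 1.
  elim: (enum _) => [|i s [U [Uc UP]]].
    by exists [::]; split => // x xO; split => //; left.
  have [w iw] := drain_exists i.
  exists (w ++ U); split.
    by apply: charged_cat => //; split; [exact: drain_law iw|
      exact: drain_increments iw].
  move=> x xO; rewrite run_cat.
  have yO : orth (run orth x w) by exact: run_cset.
  have [h1 h2] := UP _ yO.
  have [yx|yx] := run_drain iw xO.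
    rewrite yx in h1 h2 *; split => // k; rewrite inE => /orP[/eqP -> xi|/h2//].
    by have := run_drain_exit iw xO xi; rewrite yx; lia.
  have lt : tot (run orth (run orth x w) U) <= tot x - 1.
    by case: h1 => [->//|]; lia.
  by split => //; right.
exists U; split => // [x xO x0|]; last first.
  have [[//|lt0] _] := UP _ orth0.
  by have := tot_ge0 (run_cset U orth0); move: lt0; rewrite tot0; lia.
suff [i xi] : exists i, 1 <= x i 0.
  by have [_ /(_ i)] := UP x xO; apply => //; rewrite mem_enum.
apply: contrapT => h; move/negP : x0; apply; apply/eqP/matrixP => i j.
rewrite ord1 mxE; apply: le_anti; have /orthP -> := xO; rewrite andbT leNgt.
by apply/negP => xi; apply: h; exists i.
Qed.

(** In the use made of it, [z] is the state of the walk started empty and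
    [x - z] the surplus of a second walk; the surplus loses a customer unless
    the second walk is emptied altogether. *)
Definition flushing (L : nat) W := forall x z,
  orth z -> orth (x - z) -> tot z <= L%:Z ->
  run orth z W = 0 /\ (run orth x W = 0 \/ tot (run orth x W) <= tot x - tot z - 1).

(** Repeating the word of [flush_one] empties any state of total at most [L];
    by the coupling the larger state then keeps only its surplus, and one more
    repetition removes a customer from it. *)
Lemma flush_word (L : nat) :
  exists W, [/\ charged W, (0 < size W)%N & flushing L W].
Proof.
have [U [Uc UP U0]] := flush_one.
pose U_ n := flatten (nseq n U).
have U_c n : charged (U_ n).
  by elim: n => [|n ih]; [split|exact: charged_cat].
have U_0 n (z : 'cV[int]_d.+1) :
    orth z -> tot z <= n%:Z -> run orth z (U_ n) = 0.
  elim: n z => [|n ih] z zO zn; first exact: tot_eq0.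
  rewrite /U_/= run_cat ih ?run_cset//.
  have [->|z0] := eqVneq z 0; first by rewrite U0 tot0.
  by have := UP _ zO z0; lia.
exists (U_ L ++ U); split.
- exact: charged_cat.
- suff : (0 < size U)%N by rewrite size_cat; lia.
  rewrite lt0n; apply/negP => /eqP/size0nil Unil.
  have := UP (basis_vec ord0); rewrite Unil /= tot_basis_vec => /(_ _ _)/= h.
  suff : (1 : int) <= 1 - 1 by [].
  apply: h; first by apply/orthP => i; rewrite basis_vecE.
  by apply/eqP => /matrixP/(_ ord0 0); rewrite basis_vecE mxE eqxx.
- move=> x z zO xzO zL; rewrite !run_cat (U_0 _ z)// U0; split => //.
  have [h1 h2] := run_coupling (fun i h => h) (U_c L).2 zO xzO.
  rewrite (U_0 _ z)// subr0 in h1 h2.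
  have [->|x0] := eqVneq (run orth x (U_ L)) 0; first by left.
  by right; have := UP _ h1 x0; rewrite totB in h2; lia.
Qed.

End Drain.

(** * Path expectations and the product-form invariant measure *)

Section PathExpectation.
Context (R : realType) (d : nat) (N : jackson_network R d.+1).
Implicit Types (f g : seq 'cV[int]_d.+1 -> R) (s u w : seq 'cV[int]_d.+1).

(** Expectation of a function of the first [k] increments. *)
Fixpoint EX k f : R :=
  if k is j.+1 then Estep N (fun v => EX j (fun s => f (v :: s))) else f [::].

Lemma EX_le k f g :
  (forall s, size s = k -> {subset s <= @increments d.+1} -> f s <= g s) ->
  EX k f <= EX k g.
Proof.
elim: k f g => [|k ih] f g fg /=; first exact: fg.
apply: Estep_le => v vI; apply: ih => s sk sI; apply: fg => /=; first by rewrite sk.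
by move=> u; rewrite inE => /orP[/eqP ->//|/sI].
Qed.

Lemma EX_eq k f g :
  (forall s, size s = k -> {subset s <= @increments d.+1} -> f s = g s) ->
  EX k f = EX k g.
Proof.
by move=> fg; apply/eqP; rewrite eq_le !EX_le// => s sk sI; rewrite fg.
Qed.

Lemma EXD k f g : EX k (fun s => f s + g s) = EX k f + EX k g.
Proof.
elim: k f g => [//|k ih] f g /=.
by rewrite -EstepD; congr (Estep N _); apply/funext => v; exact: ih.
Qed.

Lemma EXZ k c f : EX k (fun s => c * f s) = c * EX k f.
Proof.
elim: k f => [//|k ih] f /=.
by rewrite -EstepZ; congr (Estep N _); apply/funext => v; exact: ih.
Qed.

Lemma EX_cst k c : EX k (fun => c) = c.
Proof.
elim: k => [//|k ih] /=; rewrite -[RHS](Estep_cst N).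
by congr (Estep N _); apply/funext.
Qed.

Lemma EX_sum (T : Type) (r : seq T) (P : pred T)
    (F : T -> seq 'cV[int]_d.+1 -> R) k :
  EX k (fun s => \sum_(t <- r | P t) F t s) = \sum_(t <- r | P t) EX k (F t).
Proof.
elim: r => [|t r ih].
  rewrite big_nil -[RHS](EX_cst k).
  by apply: EX_eq => s _ _; rewrite big_nil.
rewrite big_cons -ih; case: ifP => Pt.
  by rewrite -EXD; apply: EX_eq => s _ _; rewrite big_cons Pt.
by apply: EX_eq => s _ _; rewrite big_cons Pt.
Qed.

Lemma EX_cat j k f :
  EX (j + k) f = EX j (fun s => EX k (fun u => f (s ++ u))).
Proof.
elim: j f => [//|j ih] f; rewrite addSn /=.
by congr (Estep N _); apply/funext => v; exact: ih.
Qed.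

Lemma EX_take j k f : (j <= k)%N -> EX k (fun s => f (take j s)) = EX j f.
Proof.
move=> jk; rewrite -(subnKC jk) EX_cat; apply: EX_eq => s sj _.
rewrite -[RHS](EX_cst (k - j)); apply: EX_eq => u _ _.
by rewrite take_size_cat.
Qed.

Lemma EX_rcons k f :
  EX k.+1 f = EX k (fun s => Estep N (fun v => f (rcons s v))).
Proof.
rewrite -addn1 EX_cat; apply: EX_eq => s _ _ /=.
by congr (Estep N _); apply/funext => v; rewrite cats1.
Qed.

Lemma EX_Estep k (h : seq 'cV[int]_d.+1 -> 'cV[int]_d.+1 -> R) :
  EX k (fun s => Estep N (h s)) = Estep N (fun v => EX k (h^~ v)).
Proof.
rewrite /Estep !EXD !EX_sum; congr (_ + _ + _); apply: eq_bigr => i _.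
- by rewrite EXZ.
- by rewrite EX_sum; apply: eq_bigr => j _; rewrite EXZ.
- by rewrite EXZ.
Qed.

Lemma EX_word w :
  EX (size w) (fun u => (u == w)%:R) = \prod_(v <- w) increment_law N v.
Proof.
elim: w => [|v w ih]; first by rewrite big_nil.
rewrite big_cons increment_lawE mulrC -EstepZ /=.
congr (Estep N _); apply/funext => u; rewrite -ih mulrC -EXZ.
apply: EX_eq => s _ _; rewrite eqseq_cons [v == u]eq_sym.
by do 2!case: (_ == _); rewrite /= ?mul1r ?mul0r ?mulr1 ?mulr0.
Qed.

End PathExpectation.

Section Invariant.
Context (R : realType) (d : nat) (N : jackson_network R d.+1).
Context (nu : 'I_d.+1 -> R) (hnu : traffic_solution N nu).
Context (hstable : forall i, nu i < service N i).
Implicit Types (x v : 'cV[int]_d.+1).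

Definition load i : R := nu i / service N i.

Lemma load_ge0 i : 0 <= load i.
Proof.
by rewrite divr_ge0 ?service_ge0//; exact: traffic_solution_ge0 hnu i.
Qed.

Lemma load_lt1 i : load i < 1.
Proof. by rewrite ltr_pdivrMr ?service_gt0// mul1r. Qed.

Lemma service_load i : service N i * load i = nu i.
Proof. by rewrite mulrC divfK// gt_eqF// service_gt0. Qed.

(** The stationary law of a stable network, up to normalization. *)
Definition jackson_weight x : R :=
  if orth x then \prod_i load i ^+ absz (x i 0) else 0.

Lemma jackson_weight_ge0 x : 0 <= jackson_weight x.
Proof.
by rewrite /jackson_weight; case: ifP => // _; apply: prodr_ge0 => i _;
  rewrite exprn_ge0// load_ge0.
Qed.

Lemma orth_basis_vec i : orth (basis_vec i : 'cV[int]_d.+1).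
Proof. by apply/orthP => k; rewrite basis_vecE. Qed.

Lemma orthD x v : orth x -> orth v -> orth (x + v).
Proof.
by move=> /orthP x0 /orthP v0; apply/orthP => i; rewrite cvD addr_ge0.
Qed.

Lemma jackson_weightD x i : orth x ->
  jackson_weight (x + basis_vec i) = load i * jackson_weight x.
Proof.
move=> xO; rewrite /jackson_weight xO (orthD xO (orth_basis_vec i)).
rewrite [LHS](bigD1 i)//= [in RHS](bigD1 i)//= mulrA -exprS; congr (_ ^+ _ * _).
  by rewrite cvD basis_vecE eqxx; have /orthP/(_ i) := xO; lia.
apply: eq_bigr => k /negPf ki.
by rewrite cvD basis_vecE ki addr0.
Qed.

Lemma orth_sub_basis x i : orth x -> orth (x - basis_vec i) = (1 <= x i 0).
Proof.
move=> xO; apply/orthP/idP => [/(_ i)|xi k].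
  by rewrite cvD cvN basis_vecE eqxx; lia.
rewrite cvD cvN basis_vecE; have [->|ki] := eqVneq k i; first by lia.
by have /orthP/(_ k) := xO; rewrite subr0.
Qed.

Lemma sum_exit_flow : \sum_i nu i * exit_prob N i = \sum_i arrival N i.
Proof.
rewrite /exit_prob; under eq_bigr do rewrite mulrBr mulr1 mulr_sumr.
rewrite sumrB exchange_big/= -sumrB; apply: eq_bigr => i _.
by rewrite {1}hnu addrK.
Qed.

(** Jackson's product form is an invariant measure: departures from [x] balance
    against the traffic equation.  The second summand is the mass that stays at
    [x] because the increment is blocked there. *)
Lemma jackson_weight_invariant x : orth x ->
  Estep N (fun v => jackson_weight (x - v)
                    + (~~ orth (x + v))%:R * jackson_weight x)
  <= jackson_weight x.
Proof.
move=> xO.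
have stay_service i : (~~ orth (x - basis_vec i))%:R = (~~ (1 <= x i 0))%:R :> R.
  by rewrite orth_sub_basis.
pose y i := (1 <= x i 0)%R%:R * jackson_weight (x - basis_vec i).
have yE i : nu i * y i = service N i * ((1 <= x i 0)%R%:R * jackson_weight x).
  rewrite /y; case: (boolP (1 <= x i 0)) => xi; last by rewrite !mul0r !mulr0.
  rewrite !mul1r -service_load -mulrA -jackson_weightD ?orth_sub_basis//.
  by rewrite subrK.
(* [y i] is the weight of the state from which an arrival at [i] leads to [x] *)
have arrE i : jackson_weight (x - basis_vec i)
    + (~~ orth (x + basis_vec i))%:R * jackson_weight x <= y i.
  rewrite (orthD xO (orth_basis_vec i)) mul0r addr0 /y.
  have [xi|xi] := boolP (1 <= x i 0); first by rewrite mul1r.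
  by rewrite /jackson_weight orth_sub_basis// (negPf xi) mulr0.
have extE i : jackson_weight (x - - basis_vec i)
    + (~~ orth (x - basis_vec i))%:R * jackson_weight x
  = load i * jackson_weight x + (~~ (1 <= x i 0))%:R * jackson_weight x.
  by rewrite opprK jackson_weightD// stay_service.
have rouE i j : jackson_weight (x - (- basis_vec i + basis_vec j))
    + (~~ orth (x + (- basis_vec i + basis_vec j)))%:R * jackson_weight x
  <= load i * y j + (~~ (1 <= x i 0))%:R * jackson_weight x.
  rewrite opprD opprK; have [<-|ij] := eqVneq i j.
    rewrite subrr addNr !addr0 xO mul0r addr0 /y.
    have [xi|xi] := boolP (1 <= x i 0); last first.
      by rewrite mul0r mulr0 add0r mul1r.
    by rewrite mul0r addr0 mul1r -jackson_weightD ?orth_sub_basis// subrK.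
  apply: lerD; last first.
    rewrite ler_wpM2r ?jackson_weight_ge0// ler_nat.
    case: (boolP (1 <= x i 0)) => xi; last exact: leq_b1.
    by rewrite addrA orthD ?orth_basis_vec// orth_sub_basis.
  rewrite /y; have [xj|xj] := boolP (1 <= x j 0).
    by rewrite mul1r -jackson_weightD ?orth_sub_basis// addrA addrAC.
  rewrite mul0r mulr0 /jackson_weight ifF//; apply/negP => /orthP/(_ j).
  rewrite !cvD cvN !basis_vecE eqxx eq_sym (negPf ij).
  by move: xj; rewrite /=; lia.
have totE : jackson_weight x = \sum_i arrival N i * y i
  + \sum_i \sum_j service N i * routing N i j *
      (load i * y j + (~~ (1 <= x i 0))%:R * jackson_weight x)
  + \sum_i service N i * exit_prob N i *
      (load i * jackson_weight x + (~~ (1 <= x i 0))%:R * jackson_weight x).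
  have -> : \sum_i \sum_j service N i * routing N i j *
      (load i * y j + (~~ (1 <= x i 0))%:R * jackson_weight x) =
    \sum_j (\sum_i nu i * routing N i j) * y j +
    \sum_i service N i * (\sum_j routing N i j) *
       ((~~ (1 <= x i 0))%:R * jackson_weight x).
    under [X in _ = X + _]eq_bigr do rewrite mulr_suml.
    rewrite [X in _ = X + _]exchange_big -big_split/=; apply: eq_bigr => i _.
    rewrite mulr_sumr mulr_suml -big_split/=; apply: eq_bigr => j _.
    by rewrite -service_load; ring.
  rewrite addrA -big_split/=.
  under [X in _ = X + _ + _]eq_bigr do rewrite -mulrDl -hnu yE.
  rewrite -addrA -big_split/=.
  under [X in _ = _ + X]eq_bigr => i _.
    rewrite (_ : service N i * _ * _ + _ = nu i * exit_prob N i * jackson_weight x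
      + service N i * ((~~ (1 <= x i 0))%:R * jackson_weight x)); last first.
      by rewrite -service_load /exit_prob; ring.
    over.
  rewrite [X in _ = _ + X]big_split/= -mulr_suml sum_exit_flow addrCA -big_split/=.
  under [X in _ = _ + X]eq_bigr => i _.
    rewrite -mulrDr -mulrDl (_ : _ + _ = 1) ?mul1r; last first.
      by case: (1 <= x i 0); rewrite /= ?addr0 ?add0r.
    over.
  by rewrite -mulr_suml -mulrDl rates_normalized mul1r.
rewrite [leRHS]totE /Estep !lerD//; apply: ler_sum => i _.
- by rewrite ler_wpM2l ?arrival_ge0.
- apply: ler_sum => j _.
  by rewrite ler_wpM2l ?mulr_ge0 ?service_ge0 ?routing_ge0.
- by rewrite extE.
Qed.

(** The point mass at the empty state lies below the invariant measure, and this
    is preserved by each step. *)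
Lemma run0_law_le k x : orth x ->
  EX N k (fun s => (run orth 0 s == x)%:R) <= jackson_weight x.
Proof.
elim: k x => [|k ih] x xO.
  rewrite /=; case: eqP => [<-|_]; last exact: jackson_weight_ge0.
  rewrite /jackson_weight orth0 big1 // => i _.
  by rewrite mxE expr0.
rewrite EX_rcons; apply: le_trans (jackson_weight_invariant xO).
apply: (@le_trans _ _ (EX N k (fun s => Estep N (fun v =>
    (orth (x - v))%:R * (run orth 0 s == x - v)%:R
    + (~~ orth (x + v))%:R * (run orth 0 s == x)%:R)))).
  apply: EX_le => s _ sI; apply: Estep_le => v vI.
  rewrite -cats1 run_cat /= /constrain; set z := run orth 0 s.
  have zO : orth z by apply: run_cset; exact: orth0.
  case: ifPn => zv.
    apply: (@le_trans _ _ ((orth (x - v))%:R * (z == x - v)%:R)); last first.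
      by rewrite lerDl mulr_ge0.
    have [<-|_] := eqVneq (z + v) x; last by rewrite mulr_ge0.
    by rewrite addrK zO eqxx mulr1.
  rewrite addr0; have [zx|_] := eqVneq z x; last by rewrite addr_ge0 ?mulr_ge0.
  by rewrite -zx zv mulr1 lerDr mulr_ge0.
rewrite EX_Estep; apply: Estep_le => v _.
rewrite EXD !EXZ lerD//; last by rewrite ler_wpM2l// ih.
have [xvO|_] := boolP (orth (x - v)); first by rewrite mul1r ih.
by rewrite mul0r jackson_weight_ge0.
Qed.

End Invariant.

(** * Uniform tail bounds from the empty state *)

Section Tail.
Context (R : realType) (d : nat) (N : jackson_network R d.+1).
Context (nu : 'I_d.+1 -> R) (hnu : traffic_solution N nu).
Context (hstable : forall i, nu i < service N i).
Implicit Types (x v : 'cV[int]_d.+1).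

(** The square is what [run0_tail] needs: one factor [r] gives the decay, the
    other one the summability over all states. *)
Lemma load_le_sqr : exists r : R, 0 < r < 1 /\ forall i, load N nu i <= r ^+ 2.
Proof.
pose rho := \big[Num.max/0]_i load N nu i.
have rho_lt1 : rho < 1.
  rewrite /rho; elim/big_ind: _ => //= [a b a1 b1|i _].
    by rewrite gt_max a1 b1.
  exact: load_lt1.
have rho_ge0 : 0 <= rho by exact: bigmax_ge_id.
exists ((1 + rho) / 2); split; first by apply/andP; split; lra.
move=> i; apply: (@le_trans _ _ rho); first exact: le_bigmax.
rewrite -subr_ge0 (_ : _ - _ = ((1 - rho) / 2) ^+ 2) ?sqr_ge0//.
by field.
Qed.

Lemma tot_abs x : orth x -> tot x = (\sum_i absz (x i 0%R))%:Z.
Proof.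
move=> /orthP x0; rewrite /tot (big_morph Posz PoszD erefl).
by apply: eq_bigr => i _; rewrite gez0_abs.
Qed.

Lemma jackson_weight_le (r : R) (L : nat) x : 0 < r < 1 ->
  (forall i, load N nu i <= r ^+ 2) -> orth x -> L%:Z <= tot x ->
  jackson_weight N nu x <= r ^+ L * \prod_i r ^+ absz (x i 0).
Proof.
move=> /andP[r0 r1] lr xO Lx; rewrite /jackson_weight xO.
apply: (@le_trans _ _ (\prod_i (r ^+ absz (x i 0) * r ^+ absz (x i 0)))).
  apply: ler_prod => i _; rewrite exprn_ge0 ?load_ge0//=.
  by rewrite -expr2 exprAC lerXn2r ?nnegrE ?exprn_ge0 ?load_ge0 ?(ltW r0).
rewrite big_split/= ler_wpM2r//.
  by apply: prodr_ge0 => i _; rewrite exprn_ge0// ltW.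
rewrite prodrXr ler_wiXn2l ?(ltW r0) ?(ltW r1)//.
by move: Lx; rewrite tot_abs// lez_nat.
Qed.

Lemma run_tot_le S x s : {subset s <= @increments d.+1} ->
  tot (run S x s) <= tot x + (size s)%:Z.
Proof.
elim: s x => [|v s ih] x sI /=; first by rewrite addr0.
have vI : v \in @increments d.+1 by apply: sI; rewrite mem_head.
have sI' : {subset s <= @increments d.+1}.
  by move=> u us; apply: sI; rewrite inE us orbT.
apply: (le_trans (ih _ sI')).
by rewrite intS addrA lerD2r; have /andP[] := step_tot S x vI.
Qed.

Lemma coord_le_tot x i : orth x -> x i 0 <= tot x.
Proof.
by move=> /orthP x0; rewrite /tot (bigD1 i)//= lerDl; apply: sumr_ge0.
Qed.

Lemma run0_tail : exists C r : R, [/\ 0 <= C, 0 < r < 1 &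
  forall k L, EX N k (fun s => (L%:Z <= tot (run orth 0 s))%R%:R) <= C * r ^+ L].
Proof.
have [r [r01 lr]] := load_le_sqr.
have /andP[r0 r1] := r01.
have omr : 0 < 1 - r by lra.
exists ((1 - r)^-1 ^+ d.+1), r; split => //.
  by rewrite exprn_ge0// invr_ge0 ltW.
move=> k L.
(* after [k] steps no queue is longer than [k], so a finite box contains the
   walk *)
pose vec (f : {ffun 'I_d.+1 -> 'I_k.+1}) : 'cV[int]_d.+1 := \col_i (f i)%:Z.
have vecE f i : vec f i 0 = (f i)%:Z by rewrite mxE.
have vecO f : orth (vec f) by apply/orthP => i; rewrite vecE.
apply: (@le_trans _ _ (\sum_(f | L%:Z <= tot (vec f))
    EX N k (fun s => (run orth 0 s == vec f)%:R))).
  rewrite -EX_sum; apply: EX_le => s sk sI.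
  have zO : orth (run orth 0 s) by apply: run_cset; exact: orth0.
  have [Lz|_] := boolP (L%:Z <= tot (run orth 0 s))%R; last first.
    by apply: sumr_ge0.
  pose f : {ffun 'I_d.+1 -> 'I_k.+1} :=
    [ffun i => inord (absz (run orth 0 s i 0))].
  have fE : vec f = run orth 0 s.
    apply/matrixP => i j; rewrite ord1 vecE ffunE inordK.
      by rewrite gez0_abs//; have /orthP := zO.
    have := coord_le_tot i zO; have := run_tot_le orth 0 sI.
    by have /orthP/(_ i) := zO; rewrite tot0 sk; lia.
  rewrite (bigD1 f)/= fE// eqxx lerDl.
  by apply: sumr_ge0.
apply: (@le_trans _ _ (\sum_(f : {ffun 'I_d.+1 -> 'I_k.+1})
    r ^+ L * \prod_i r ^+ f i)).
  rewrite [leRHS](bigID (fun f => L%:Z <= tot (vec f)))/= -[leLHS]addr0.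
  apply: lerD; last first.
    apply: sumr_ge0 => f _; rewrite mulr_ge0 ?exprn_ge0 ?(ltW r0)//.
    by apply: prodr_ge0 => i _; rewrite exprn_ge0// ltW.
  apply: ler_sum => f Lf; apply: le_trans (run0_law_le hnu k (vecO f)) _.
  apply: le_trans (jackson_weight_le r01 lr (vecO f) Lf) _.
  by under eq_bigr do rewrite vecE.
rewrite -mulr_sumr mulrC ler_wpM2r ?exprn_ge0 ?(ltW r0)//.
rewrite -(bigA_distr_bigA (fun _ (j : 'I_k.+1) => r ^+ j))/=.
rewrite prodr_const card_ord lerXn2r ?nnegrE//.
- by apply: sumr_ge0 => i _; rewrite exprn_ge0// ltW.
- by rewrite invr_ge0 ltW.
rewrite -(ler_pM2l omr) mulfV ?gt_eqF//.
have := subrX1 r k.+1; have : 0 <= r ^+ k.+1 by rewrite exprn_ge0// ltW.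
set Z := \sum_(_ < _) _; lra.
Qed.
Lemma run0_max_tail (c : R) (L H : nat) :
  (forall k, EX N k (fun s => (L%:Z <= tot (run orth 0 s))%R%:R) <= c) ->
  EX N H (fun s =>
    (has (fun k => L%:Z <= tot (run orth 0 (take k s))) (iota 0 H.+1))%:R)
    <= H.+1%:R * c.
Proof.
move=> tail; apply: (@le_trans _ _ (EX N H (fun s => \sum_(k < H.+1)
    (L%:Z <= tot (run orth 0 (take k s)))%R%:R))).
  apply: EX_le => s _ _; case: hasP => [[k]|_]; last exact: sumr_ge0.
  rewrite mem_iota add0n => /= kH hk.
  by rewrite (bigD1 (Ordinal kH))//= hk lerDl; exact: sumr_ge0.
rewrite EX_sum -[H.+1]card_ord mulr_natl -sumr_const card_ord.
apply: ler_sum => k _; apply: le_trans (tail k).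
have kH : (k <= H)%N by rewrite -ltnS.
by rewrite -(EX_take N (fun s => (L%:Z <= tot (run orth 0 s))%R%:R) kH).
Qed.
End Tail.

(** * Counting flushes *)

Section Blocks.
Variables (d : nat) (L : nat) (W : seq 'cV[int]_d.+1).
Implicit Types (s u : seq 'cV[int]_d.+1) (x : 'cV[int]_d.+1).
Local Notation l := (size W).

(** The word [W] is sure to remove a surplus customer only from states in which
    the walk started empty is low, so only blocks that begin there count. *)
Definition low s : bool := tot (run orth 0 s) <= L%:Z.

Definition trials M s : nat := \sum_(b < M) low (take (b * l) s).

Definition flushes M s : nat :=
  \sum_(b < M) (low (take (b * l) s) && (take l (drop (b * l) s) == W)).

Lemma trials_cat M s u : size s = (M * l)%N ->
  trials M.+1 (s ++ u) = (trials M s + low s)%N.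
Proof.
move=> sM; rewrite /trials big_ord_recr/= take_cat sM ltnn subnn take0 cats0.
congr (_ + _)%N; apply: eq_bigr => b _.
by rewrite takel_cat// sM leq_mul2r ltnW ?orbT.
Qed.

Lemma flushes_cat M s u : size s = (M * l)%N -> size u = l ->
  flushes M.+1 (s ++ u) = (flushes M s + (low s && (u == W)))%N.
Proof.
move=> sM ul; rewrite /flushes big_ord_recr/= take_cat sM ltnn subnn take0 cats0.
rewrite drop_cat sM ltnn subnn drop0 -ul take_size ul.
congr (_ + _)%N; apply: eq_bigr => b _.
have bM : (b.+1 * l <= M * l)%N by rewrite leq_mul2r ltn_ord orbT.
rewrite takel_cat ?sM; last by rewrite leq_mul2r ltnW ?orbT.
congr (nat_of_bool (_ && (_ == _))).
rewrite mulSn in bM.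
rewrite drop_cat sM; case: ltnP => [_|Mb].
  by rewrite takel_cat// size_drop sM; lia.
have l0 : l = 0%N by lia.
by rewrite l0 !take0.
Qed.

Hypothesis flushW : flushing L W.

(** Between flushes the surplus over the walk started empty cannot grow, and each
    flush lowers it or leaves the network empty. *)
Lemma run_flushes M s x : size s = (M * l)%N -> {subset s <= @increments d.+1} ->
  orth x -> (exists2 k, (k <= M * l)%N & run orth x (take k s) = 0) \/
    tot (run orth x s) + (flushes M s)%:Z <= tot (run orth 0 s) + tot x.
Proof.
elim: M s => [|M ih] s.
  move=> /size0nil -> _ xO; right.
  by rewrite /= /flushes big_ord0 addr0 tot0 add0r.
move=> sM sI xO; set s1 := take (M * l) s; set u := drop (M * l) s.
have s1M : size s1 = (M * l)%N.
  by rewrite size_takel// sM leq_mul2r leqnSn orbT.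
have ul : size u = l by rewrite size_drop sM; lia.
have sE : s = s1 ++ u by rewrite cat_take_drop.
have s1I : {subset s1 <= @increments d.+1} by move=> v /mem_take/sI.
have uI : {subset u <= @increments d.+1} by move=> v /mem_drop/sI.
have [[k kM xk]|h] := ih _ s1M s1I xO.
  left; exists k; first by rewrite mulSn (leq_trans kM)// leq_addl.
  by rewrite sE takel_cat ?s1M.
rewrite sE flushes_cat// !run_cat; set z := run orth 0 s1; set x1 := run orth x s1.
have zO : orth z by exact/run_cset/orth0.
have xzO : orth (x1 - z).
  by apply: (run_coupling (fun i h => h) s1I (orth0 _) _).1; rewrite subr0.
have [lowu|_] := boolP (low s1 && (u == W)); last first.
  right; rewrite addn0.
  have [_] := run_coupling (fun i h => h) uI zO xzO.
  by rewrite !totB; move: h; rewrite -/z -/x1; lia.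
have /andP[lows /eqP uW] := lowu.
have [z0 [x0|xlt]] := flushW zO xzO lows.
  left; exists (M.+1 * l)%N => //.
  by rewrite take_oversize ?size_cat ?s1M ?ul -?mulSnr// run_cat uW.
right; rewrite uW z0 tot0; move: h; rewrite -/z -/x1 PoszD; lia.
Qed.

(** Two walks never cross, so more flushes than initial customers are
    impossible before the origin is visited. *)
Lemma run_flushed M s x : size s = (M * l)%N -> {subset s <= @increments d.+1} ->
  orth x -> tot x < (flushes M s)%:Z ->
  exists2 k, (k <= M * l)%N & run orth x (take k s) = 0.
Proof.
move=> sM sI xO xV; have [//|h] := run_flushes sM sI xO.
have : orth (run orth x s - run orth 0 s).
  by apply: (run_coupling (fun i h => h) sI (orth0 _) _).1; rewrite subr0.
by move=> /tot_ge0; rewrite totB; lia.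
Qed.
End Blocks.

(** Half of the geometric decay is spent on the linear factor, by Bernoulli's
    inequality. *)
Lemma linear_geometric_small (R : realType) (r A e : R) :
  0 < r < 1 -> 0 <= A -> 0 < e ->
  exists n0, forall n, (n0 <= n)%N -> A * n.+1%:R * r ^+ n <= e.
Proof.
move=> /andP[r0 r1] A0 e0.
(* [t] is chosen with [r <= t ^+ 2]: one factor [t ^+ n] absorbs [n.+1]. *)
pose t := (1 + r) / 2; pose h := t^-1 - 1.
have t0 : 0 < t by rewrite /t; lra.
have t1 : t < 1 by rewrite /t; lra.
have h0 : 0 < h by rewrite /h subr_gt0 invf_gt1.
have bern n : t ^+ n * (1 + n%:R * h) <= 1.
  elim: n => [|n ih]; first by rewrite expr0 mul0r addr0 mulr1.
  apply: le_trans ih; rewrite exprSr -mulrA ler_wpM2l ?exprn_ge0 ?(ltW t0)//.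
  have -> : h = t^-1 - 1 by [].
  rewrite -(ler_pM2l t0) -subr_ge0 -natr1.
  have -> : t * (1 + n%:R * (t^-1 - 1)) - t * (t * (1 + (n%:R + 1) * (t^-1 - 1)))
     = n%:R * (1 - t) ^+ 2 by field; rewrite gt_eqF.
  by rewrite mulr_ge0 ?sqr_ge0.
pose K := 1 + h^-1.
have K0 : 0 < K by rewrite /K addr_gt0 ?invr_gt0.
exists (Num.truncn (A * K / (e * h))).+1 => n nn.
have nAK : A * K <= e * (n%:R * h).
  rewrite mulrCA -ler_pdivrMr ?mulr_gt0//.
  apply: (@le_trans _ _ (Num.truncn (A * K / (e * h))).+1%:R); last by rewrite ler_nat.
  by rewrite ltW// truncnS_gt.
have tn : 0 <= t ^+ n by rewrite exprn_ge0// ltW.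
have rt : r ^+ n <= t ^+ n * t ^+ n.
  rewrite -exprMn; apply: lerXn2r; rewrite ?nnegrE ?(ltW r0)//.
    by rewrite mulr_ge0 ?(ltW t0).
  rewrite -subr_ge0 (_ : t * t - r = ((1 - r) / 2) ^+ 2) ?sqr_ge0// /t.
  by field.
have nK : n.+1%:R <= K * (1 + n%:R * h).
  rewrite -natr1 -subr_ge0 /K.
  rewrite (_ : _ - (n%:R + 1) = h^-1 + n%:R * h); last by field; rewrite gt_eqF.
  by rewrite addr_ge0 ?mulr_ge0 ?invr_ge0 ?(ltW h0).
have ntK : n.+1%:R * t ^+ n <= K.
  apply: (@le_trans _ _ (K * (1 + n%:R * h) * t ^+ n)); first by rewrite ler_wpM2r.
  by rewrite -mulrA [_ * t ^+ n]mulrC -[leRHS]mulr1 ler_wpM2l// ltW.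
apply: (@le_trans _ _ (A * K * t ^+ n)).
  apply: (@le_trans _ _ (A * (n.+1%:R * t ^+ n) * t ^+ n)).
    by rewrite -!mulrA !ler_wpM2l.
  by rewrite ler_wpM2r// ler_wpM2l.
apply: (@le_trans _ _ (e * (t ^+ n * (1 + n%:R * h)))); last first.
  by rewrite -[leRHS]mulr1 ler_wpM2l// ltW.
rewrite mulrCA mulrC ler_wpM2l// (le_trans nAK)// ler_wpM2l ?(ltW e0)//.
by rewrite lerDr.
Qed.

Section Count.
Context (R : realType) (d : nat) (N : jackson_network R d.+1).
Implicit Types (s u : seq 'cV[int]_d.+1) (x : 'cV[int]_d.+1).

Section SecondMoment.
Variables (L : nat) (W : seq 'cV[int]_d.+1).
Local Notation l := (size W).
Local Notation q := (\prod_(v <- W) increment_law N v).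

Lemma EX_word_sqr (a b : R) :
  EX N l (fun u => (a + b * ((u == W)%:R - q)) ^+ 2) = a ^+ 2 + b ^+ 2 * (q * (1 - q)).
Proof.
transitivity (EX N l (fun u => (a - b * q) ^+ 2
   + ((a - b * q + b) ^+ 2 - (a - b * q) ^+ 2) * (u == W)%:R)).
  by apply: EX_eq => u _ _; case: eqP => _ /=; ring.
by rewrite EXD EX_cst EXZ EX_word; ring.
Qed.

Lemma word_prob_ge0 : 0 <= q.
Proof. by apply: prodr_ge0 => v _; exact: increment_law_ge0. Qed.

Lemma word_prob_le1 : q <= 1.
Proof.
rewrite -EX_word -[leRHS](EX_cst N l); apply: EX_le => s _ _.
by case: eqP; rewrite ?ler01.
Qed.

(** The flushes minus [q] times the trials form a martingale with increments
    bounded by 1. *)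
Lemma flushes_variance M :
  EX N (M * l) (fun s =>
    ((flushes L W M s)%:R - q * (trials L W M s)%:R) ^+ 2) <= M%:R.
Proof.
elim: M => [|M ih].
  by rewrite mul0n /= /flushes /trials !big_ord0 mulr0 subr0 expr0n.
rewrite mulSnr EX_cat -[M.+1]addn1 natrD.
apply: (@le_trans _ _ (EX N (M * l) (fun s =>
    ((flushes L W M s)%:R - q * (trials L W M s)%:R) ^+ 2 + 1))); last first.
  by rewrite EXD EX_cst lerD2r.
apply: EX_le => s sM sI.
rewrite -[leLHS](_ : EX N l (fun u => ((flushes L W M s)%:R
  - q * (trials L W M s)%:R + (low L s)%:R * ((u == W)%:R - q)) ^+ 2) = _).
  rewrite EX_word_sqr lerD2l.
  have q0 := word_prob_ge0; have q1 := word_prob_le1.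
  by case: (low L s); rewrite /= ?expr0n/= ?expr1n; nra.
apply: EX_eq => u ul uI; rewrite addn1 trials_cat// flushes_cat//.
by rewrite !natrD -mulnb natrM; congr (_ ^+ 2); ring.
Qed.

Lemma trials_mean (e : R) M :
  (forall k, EX N k (fun s => (~~ low L s)%:R) <= e) ->
  EX N (M * l) (fun s => M%:R - (trials L W M s)%:R) <= M%:R * e.
Proof.
move=> low_e.
apply: (@le_trans _ _ (EX N (M * l) (fun s =>
    \sum_(b < M) (~~ low L (take (b * l) s))%:R))).
  apply: EX_le => s _ _; rewrite /trials natr_sum.
  rewrite -[X in X%:R - _]card_ord -sum1_card natr_sum -sumrB.
  by apply: ler_sum => b _; case: low; rewrite /= ?subrr ?subr0.
rewrite EX_sum -[M in leRHS]card_ord -sum1_card natr_sum mulr_suml.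
apply: ler_sum => b _; rewrite mul1r.
rewrite (@EX_take _ _ N (b * l) _ (fun s => (~~ low L s)%:R))//.
by rewrite leq_mul2r ltnW ?orbT.
Qed.

(** If there are fewer than [M / kappa <= q M / 4] flushes, then either half of
    the blocks are no trials or the martingale is below [- q M / 4]. *)
Lemma flushes_few (e : R) (kappa M : nat) :
  (forall k, EX N k (fun s => (~~ low L s)%:R) <= e) ->
  (0 < M)%N -> 0 < q -> 4 <= kappa%:R * q ->
  EX N (M * l) (fun s => (flushes L W M s * kappa < M)%N%:R)
    <= 2 * e + 16 / (q ^+ 2 * M%:R).
Proof.
move=> low_e M0 q0 kq.
have MR : 0 < M%:R :> R by rewrite ltr0n.
have k0 : 0 < kappa%:R :> R.
  by rewrite -(pmulr_lgt0 _ q0); apply: lt_le_trans kq.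
apply: (@le_trans _ _ (EX N (M * l) (fun s =>
    (2 / M%:R) * (M%:R - (trials L W M s)%:R) +
    (16 / (q ^+ 2 * M%:R ^+ 2)) *
      ((flushes L W M s)%:R - q * (trials L W M s)%:R) ^+ 2))).
  apply: EX_le => s _ _; set V := flushes L W M s; set G := trials L W M s.
  have GM : G%:R <= M%:R :> R.
    rewrite ler_nat /G /trials -[leqRHS]card_ord -sum1_card.
    by apply: leq_sum => b _; case: low.
  have t1 : 0 <= (2 / M%:R) * (M%:R - G%:R) :> R.
    by rewrite mulr_ge0 ?subr_ge0// divr_ge0.
  have t2 : 0 <= (16 / (q ^+ 2 * M%:R ^+ 2)) * (V%:R - q * G%:R) ^+ 2 :> R.
    by rewrite mulr_ge0 ?sqr_ge0// divr_ge0// mulr_ge0// sqr_ge0.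
  case: ltnP => [VM|_]; last by rewrite addr_ge0.
  have VqM : V%:R <= q * M%:R / 4 :> R.
    have VkM : V%:R * kappa%:R <= M%:R :> R by rewrite -natrM ler_nat ltnW.
    rewrite ler_pdivlMr//.
    apply: (@le_trans _ _ (V%:R * (kappa%:R * q))); first by rewrite ler_wpM2l.
    by rewrite mulrA mulrC ler_wpM2l// ltW.
  have [GM2|GM2] := leP (M%:R / 2) (G%:R : R).
    rewrite -[leLHS]add0r lerD//.
    have h : q * M%:R / 4 <= q * G%:R - V%:R.
      have : q * (M%:R / 2) <= q * G%:R by rewrite ler_wpM2l// ltW.
      lra.
    have qM : 0 < q * M%:R by rewrite mulr_gt0.
    have h2 : (q * M%:R / 4) ^+ 2 <= (V%:R - q * G%:R) ^+ 2.
      rewrite -[leRHS]sqrrN opprB lerXn2r ?nnegrE//.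
        by rewrite divr_ge0// ltW.
      by apply: le_trans h; rewrite divr_ge0// ltW.
    rewrite -exprMn mulrAC ler_pdivlMr ?exprn_gt0// mul1r.
    move: h2; rewrite (_ : (q * M%:R / 4) ^+ 2 = (q * M%:R) ^+ 2 / 16); last by field.
    by rewrite ler_pdivrMr// [16 * _]mulrC.
  rewrite -[leLHS]addr0 lerD//.
  by rewrite mulrAC ler_pdivlMr// mul1r; lra.
rewrite EXD !EXZ lerD//.
  apply: (@le_trans _ _ (2 / M%:R * (M%:R * e))).
    by rewrite ler_wpM2l ?divr_ge0// trials_mean.
  by rewrite mulrA divfK// gt_eqF.
apply: (@le_trans _ _ (16 / (q ^+ 2 * M%:R ^+ 2) * M%:R)).
  by rewrite ler_wpM2l ?flushes_variance// divr_ge0// mulr_ge0// sqr_ge0.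
by rewrite le_eqVlt; apply/orP; left; apply/eqP; field; rewrite !gt_eqF.
Qed.

End SecondMoment.

Context (nu : 'I_d.+1 -> R) (hnu : traffic_solution N nu).
Context (hstable : forall i, nu i < service N i).

(** The threshold [L] is chosen first, so that few blocks fail to be trials; the
    word [W], hence its probability and the rate [1 / kappa], depends on it. *)
Lemma flush_rate (e : R) : 0 < e ->
  exists (L kappa M0 : nat) (W : seq 'cV[int]_d.+1),
  [/\ (0 < size W)%N,
    flushing L W,
    (0 < kappa)%N &
    forall M, (M0 <= M)%N ->
      EX N (M * size W) (fun s => (flushes L W M s * kappa < M)%N%:R) <= e].
Proof.
move=> e0.
have [C [r [C0 /andP[r0 r1] tail]]] := run0_tail hnu hstable.
have [L CL] : exists L : nat, C * r ^+ L.+1 <= e / 4.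
  have e4 : 0 < e / 4 by lra.
  have [|n0 hn0] := @linear_geometric_small R r C (e / 4) _ C0 e4.
    exact/andP.
  exists n0; apply: le_trans (hn0 _ (leqnSn n0)).
  by rewrite ler_wpM2r ?exprn_ge0 ?(ltW r0)// ler_peMr// ler1n.
have [W [[Wlaw _] W0 WP]] := flush_word N L.
pose q := \prod_(v <- W) increment_law N v.
have q0 : 0 < q.
  rewrite /q big_seq; apply: prodr_gt0 => v vW; exact: (allP Wlaw).
pose kappa := (Num.truncn (4 / q)).+1.
have kq : 4 <= kappa%:R * q.
  rewrite -ler_pdivrMr// ltW// /kappa; apply: truncnS_gt.
pose M0 := (Num.truncn (32 / (q ^+ 2 * e))).+1.
exists L, kappa, M0, W; split => // M MM.
have MR : 32 / (q ^+ 2 * e) <= M%:R.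
  apply: (@le_trans _ _ M0%:R); last by rewrite ler_nat.
  by apply: ltW; exact: truncnS_gt.
have M_gt0 : (0 < M)%N by apply: leq_trans MM.
apply: le_trans (flushes_few (e := e / 4) _ M_gt0 q0 kq) _.
  move=> k; apply: le_trans CL; apply: le_trans (tail k L.+1).
  apply: EX_le => s _ _; rewrite ler_nat /low; case: ltgtP => //=; lia.
have q2e : 0 < q ^+ 2 * e by rewrite mulr_gt0 ?exprn_gt0.
have : 16 / (q ^+ 2 * M%:R) <= e / 2.
  rewrite ler_pdivrMr; last by rewrite mulr_gt0 ?exprn_gt0 ?ltr0n.
  by move: MR; rewrite ler_pdivrMr//; lra.
rewrite -/q; lra.
Qed.
End Count.

(** * The joint law of the first increments *)

Lemma Estep_law (R : realType) (d : nat) (N : jackson_network R d.+1)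
    (g : 'cV[int]_d.+1 -> R) :
  \sum_(v <- undup (@increments d.+1)) increment_law N v * g v = Estep N g.
Proof.
transitivity (Estep N (fun u =>
    \sum_(v <- undup (@increments d.+1)) g v * (v == u)%:R)).
  rewrite Estep_sum; apply: eq_bigr => v _.
  by rewrite increment_lawE EstepZ mulrC.
have E u : u \in @increments d.+1 ->
    \sum_(v <- undup (@increments d.+1)) g v * (v == u)%:R = g u.
  move=> uI; rewrite (bigD1_seq u) ?mem_undup ?undup_uniq//= eqxx mulr1.
  by rewrite big1 ?addr0// => v /negPf ->; rewrite mulr0.
by apply/eqP; rewrite eq_le; apply/andP; split; apply: Estep_le => u /E ->.
Qed.

Lemma take_mkseq (T : Type) (f : nat -> T) (j k : nat) : (j <= k)%N ->
  take j (mkseq f k) = mkseq f j.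
Proof. by move=> jk; rewrite /mkseq -map_take take_iota (minn_idPl jk). Qed.

Section Law.
Context (R : realType) (d : nat) (N : jackson_network R d.+1).
Context (disp : measure_display) (T : measurableType disp).
Context (P : probability T R) (I : nat -> T -> 'cV[int]_d.+1).
Hypothesis hI : iid_increments N P I.
Local Open Scope ereal_scope.

Definition history (k : nat) (w : T) : seq 'cV[int]_d.+1 :=
  mkseq (fun j => I j w) k.

Lemma size_history k w : size (history k w) = k.
Proof. exact: size_mkseq. Qed.

Lemma take_history j k w : (j <= k)%N -> take j (history k w) = history j w.
Proof. exact: take_mkseq. Qed.

Lemma historyS k w : history k.+1 w = rcons (history k w) (I k w).
Proof. exact: mkseqS. Qed.

Lemma measurable_I k (A : set 'cV[int]_d.+1) : measurable (I k @^-1` A).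
Proof. by have [h _ _] := hI; exact: h. Qed.

Lemma measurable_history k (Q : set (seq 'cV[int]_d.+1)) :
  measurable [set w | Q (history k w)].
Proof.
elim: k Q => [|k ih] Q.
  have [q|q] := pselect (Q [::]).
    by rewrite (_ : [set _ | _] = setT)//; apply/seteqP; split.
  by rewrite (_ : [set _ | _] = set0)//; apply/seteqP; split.
rewrite (_ : [set _ | _] = \bigcup_v
    ([set w | Q (rcons (history k w) v)] `&` I k @^-1` [set v])).
  apply: countable_bigcupT_measurable => [|v]; first exact: countableP.
  by apply: measurableI; [exact: (ih (fun s => Q (rcons s v)))|exact: measurable_I].
apply/seteqP; split => [w /=|w [v _ [/= q wv]]]; rewrite /= historyS ?wv//.
by move=> q; exists (I k w).
Qed.

Lemma prob_word (u : seq 'cV[int]_d.+1) :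
  P [set w | history (size u) w = u] = (\prod_(v <- u) increment_law N v)%R%:E.
Proof.
have [_ indep law] := hI.
pose K := [fset x in iota 0 (size u)]%fset.
have := indep K (fun k => [set nth 0%R u k]).
rewrite (_ : \bigcap_(k in [set` K]) _ = [set w | history (size u) w = u]).
  move=> ->.
  rewrite (perm_big (iota 0 (size u)))/=; last first.
    apply: uniq_perm; rewrite ?fset_uniq ?iota_uniq// => k.
    by rewrite !inE.
  under eq_bigr => k _ do rewrite law.
  by rewrite prodEFin [in RHS](big_nth 0%R) /index_iota subn0.
apply/seteqP; split => w /=.
  move=> h; apply: (@eq_from_nth _ 0%R); first by rewrite size_history.
  rewrite size_history => k ku; rewrite nth_mkseq//.
  by apply: (h k); rewrite /= !inE mem_iota.
move=> h k /=; rewrite !inE mem_iota => /= ku.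
by rewrite -[in RHS]h nth_mkseq.
Qed.

Lemma prob_split_seq k (A : set T) (r : seq 'cV[int]_d.+1) : measurable A ->
  uniq r ->
  P (A `&` I k @^-1` [set` r]) = \sum_(v <- r) P (A `&` I k @^-1` [set v]).
Proof.
move=> mA; elim: r => [|v r ih] /=.
  move=> _; rewrite big_nil (_ : _ `&` _ = set0) ?measure0//.
  by apply/seteqP; split => // w [].
move=> /andP[vr ur]; rewrite big_cons -ih// -measureU.
- congr (P _); rewrite -setIUr; congr (_ `&` _); apply/seteqP; split => w /=.
    by rewrite inE => /orP[/eqP|]; [left|right].
  by rewrite inE => -[->|->]; rewrite ?eqxx ?orbT.
- by apply: measurableI => //; exact: measurable_I.
- by apply: measurableI => //; exact: measurable_I.
- apply/seteqP; split => // w [[_ /= ->] [_ /=]].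
  by rewrite (negPf vr).
Qed.

Lemma prob_increments k : P (I k @^-1` [set` @increments d.+1]) = 1.
Proof.
have [_ _ law] := hI.
rewrite (_ : [set` _] = [set` undup (@increments d.+1)]); last first.
  by apply/seteqP; split => v /=; rewrite mem_undup.
rewrite -[X in P X]setTI prob_split_seq ?undup_uniq//.
under eq_bigr do rewrite setTI law.
rewrite sumEFin -(Estep1 N) -Estep_law; congr (_%:E).
by apply: eq_bigr => v _; rewrite mulr1.
Qed.

Lemma prob_split k (A : set T) : measurable A ->
  P A = \sum_(v <- undup (@increments d.+1)) P (A `&` I k @^-1` [set v]).
Proof.
move=> mA; rewrite -prob_split_seq ?undup_uniq//.
set B := I k @^-1` _.
have mB : measurable B by exact: measurable_I.
have PB : P (~` B) = 0.
  rewrite probability_setC// /B.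
  rewrite (_ : [set` _] = [set` @increments d.+1]); last first.
    by apply/seteqP; split => v /=; rewrite mem_undup.
  by rewrite prob_increments subee.
rewrite -[in LHS](setIT A) -(setUv B) setIUr measureU; last first.
- by rewrite setIACA setICr setI0.
- by apply: measurableI => //; exact: measurableC.
- exact: measurableI.
rewrite [X in _ + X](_ : _ = 0) ?adde0//.
apply/eqP; rewrite eq_le measure_ge0 andbT -PB.
by apply: le_measure; rewrite ?inE; [apply: measurableI => //; exact: measurableC|
  exact: measurableC|].
Qed.

(** The word [u] read so far makes the induction on [k] work: reading one more
    increment lengthens [u] and shortens [k]. *)
Lemma prob_history_word k (u : seq 'cV[int]_d.+1)
    (Q : pred (seq 'cV[int]_d.+1)) :
  P ([set w | history (size u) w = u] `&` [set w | Q (history (size u + k) w)]) =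
  (\prod_(v <- u) increment_law N v * EX N k (fun s => (Q (u ++ s))%:R))%R%:E.
Proof.
elim: k u => [|k ih] u /=.
  rewrite addn0 cats0; case Qu: (Q u); last first.
    rewrite mulr0 (_ : _ `&` _ = set0) ?measure0//.
    by apply/seteqP; split => // w [/= -> ]; rewrite Qu.
  rewrite mulr1 -prob_word; congr (P _); apply/seteqP; split => w /=.
    by case.
  by move=> wu; rewrite wu Qu.
rewrite (prob_split (size u)); last first.
  by apply: measurableI; [exact: (measurable_history _ (fun s => s = u))|
    exact: (measurable_history _ (fun s => Q s))].
rewrite -Estep_law big_distrr/= -sumEFin; apply: eq_bigr => v _.
have := ih (rcons u v); rewrite size_rcons addSnnS => ihv.
rewrite (_ : _ `&` _ `&` _ =
    [set w | history (size u).+1 w = rcons u v]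
    `&` [set w | Q (history (size u + k.+1) w)]); last first.
  apply/seteqP; split => w /=.
    by move=> [[wu Qw] wv]; rewrite historyS wu wv.
  rewrite historyS => -[/rcons_inj[-> ->] Qw]; split => //.
rewrite ihv -cats1 big_cat big_seq1 mulrA; congr (_ * _)%R%:E.
by apply: EX_eq => s _ _; rewrite -catA.
Qed.

(** All probabilities over a finite horizon thereby become finite sums. *)
Lemma prob_history k (Q : pred (seq 'cV[int]_d.+1)) :
  P [set w | Q (history k w)] = (EX N k (fun s => (Q s)%:R))%:E.
Proof.
have := prob_history_word k [::] Q; rewrite big_nil mul1r add0n => <-.
by congr (P _); apply/seteqP; split => w //= [].
Qed.

(** Almost surely all increments are transitions of the network. *)
Lemma le_prob_increments (A B : set T) : measurable A -> measurable B ->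
  (forall w, (forall k, I k w \in @increments d.+1) -> A w -> B w) ->
  P A <= P B.
Proof.
move=> mA mB AB.
pose bad := \bigcup_k (I k @^-1` (~` [set` @increments d.+1])).
have mbad : measurable bad.
  by apply: bigcupT_measurable => k; exact: measurable_I.
have bad0 : P bad = 0.
  apply/negligibleP => //; apply: negligible_bigcup => k.
  apply/negligibleP; first exact: measurable_I.
  have : P (~` (I k @^-1` [set` @increments d.+1])) = 0.
    rewrite probability_setC; last exact: measurable_I.
    by rewrite prob_increments subee.
  by rewrite preimage_setC.
apply: (@le_trans _ _ (P (B `|` bad))).
  apply: le_measure; rewrite ?inE//; first exact: measurableU.
  move=> w Aw; have [h|h] := pselect (forall k, I k w \in @increments d.+1).
    by left; exact: AB.
  by right; move/existsNP : h => [k kI]; exists k => //=; exact/negP.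
by rewrite -[leRHS]adde0 -bad0; exact: measureU2.
Qed.
End Law.

(** * Hitting times and the reflected limit process *)

Section HittingTime.
Context (R : realType) (V : Type).
Implicit Types (A B : set V) (x : nat -> V).

Lemma hitting_time_ltP A B x :
  (hitting_time R A x < hitting_time R B x)%E <->
  exists k, A (x k) /\ forall j, (j <= k)%N -> ~ B (x j).
Proof.
split.
  move=> /ereal_inf_lt[_ [k Ak <-] kB]; exists k; split => // j jk Bj.
  move: kB; rewrite ltNge => /negP; apply.
  apply: (@le_trans _ _ j%:R%:E); last by rewrite lee_fin ler_nat.
  by apply: ereal_inf_lbound; exists j.
move=> [k [Ak Bk]].
apply: (@le_lt_trans _ _ k%:R%:E); first by apply: ereal_inf_lbound; exists k.
apply: (@lt_le_trans _ _ k.+1%:R%:E); first by rewrite lte_fin ltr_nat.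
apply: le_ereal_inf_tmp => _ [j Bj <-]; rewrite lee_fin ler_nat ltnNge.
by apply/negP => /Bk.
Qed.

Lemma hitting_time_finiteP A x :
  (hitting_time R A x < +oo)%E <-> exists k, A (x k).
Proof.
split; first by move=> /ereal_inf_lt[_ [k Ak _] _]; exists k.
move=> [k Ak]; apply: (@le_lt_trans _ _ k%:R%:E); last exact: ltry.
by apply: ereal_inf_lbound; exists k.
Qed.
End HittingTime.

Section Paths.
Variable d : nat.
Implicit Types (x y : 'cV[int]_d.+1) (s : seq 'cV[int]_d.+1).

Definition free1 : pred 'I_d.+1 := fun i => i != ord0.

Lemma shift_mapE n y i : shift_map n y i 0 =
  if i == ord0 then n%:Z - y ord0 0 else y i 0.
Proof.
rewrite /shift_map /reflect1 mul_diag_mx cvD !mxE.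
have -> : (basis_vec ord0 *+ n) i 0 = (basis_vec ord0 : 'cV[int]_d.+1) i 0 *+ n.
  by elim: n => [|n ih]; [rewrite mxE|rewrite !mulrS cvD ih].
rewrite basis_vecE; have [->|i0] := eqVneq i ord0.
  by rewrite mulN1r mulr1n natz.
by rewrite mul0rn add0r mul1r.
Qed.

Lemma tot_shift_map n y :
  tot (shift_map n y) = n%:Z - y ord0 0 + \sum_(i | i != ord0) y i 0.
Proof.
rewrite /tot (bigD1 ord0)//= shift_mapE eqxx; congr (_ + _).
by apply: eq_bigr => i /negPf i0; rewrite shift_mapE i0.
Qed.

(** So reaching the boundary means, for the shifted process, total [n]. *)
Lemma boundaryB_tot n y : boundaryB y <-> OmegaY y /\ tot (shift_map n y) = n%:Z.
Proof.
rewrite tot_shift_map; split => -[yO h]; split => //; first by rewrite h; lia.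
by move: h; lia.
Qed.

Lemma OmegaY_shift n y : OmegaY y = cset free1 (shift_map n y).
Proof.
apply: eq_forallb => i; rewrite /free1 shift_mapE.
by case: eqP.
Qed.

(** In the coordinates of the network, the limit process is the walk that is not
    constrained at the first node, driven by the same increments. *)
Lemma shift_walkY n y (J : nat -> 'cV[int]_d.+1) k :
  shift_map n (walkY y J k) = run (cset free1) (shift_map n y) (mkseq J k).
Proof.
elim: k => [//|k ih]; rewrite mkseqS -cats1 run_cat -ih /=.
set z := walkY y J k.
have shiftD v : shift_map n (z + reflect1 d *m v) = shift_map n z + v.
  apply/matrixP => i j; rewrite ord1 [RHS]cvD !shift_mapE.
  rewrite /reflect1 mul_diag_mx !cvD !mxE.
  by case: eqP => [->|]; [rewrite mulN1r opprB addrA addrAC|rewrite mul1r].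
rewrite /walkY/= -/(walkY y J k) -/z /constrain.
rewrite (OmegaY_shift n) shiftD; case: ifP => _; first exact: shiftD.
by rewrite !addr0.
Qed.

Lemma walkY_OmegaY y (J : nat -> 'cV[int]_d.+1) k :
  OmegaY y -> OmegaY (walkY y J k).
Proof.
by move=> yO; rewrite (OmegaY_shift 0) shift_walkY run_cset// -OmegaY_shift.
Qed.

(** Until its first queue can have emptied, the network does not feel the
    constraint at the first node. *)
Lemma run_free1 x s : {subset s <= @increments d.+1} -> orth x ->
  (size s)%:Z <= x ord0 0 ->
  run orth x s = run (cset free1) x s /\
  x ord0 0 - (size s)%:Z <= run orth x s ord0 0.
Proof.
elim: s x => [|v s ih] x sI xO /=; first by rewrite subr0.
move=> sx.
have vI : v \in @increments d.+1 by apply: sI; rewrite mem_head.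
have sI' : {subset s <= @increments d.+1}.
  by move=> u us; apply: sI; rewrite inE us orbT.
have v1 := increment_geN1 ord0 vI.
have E : constrain (cset free1) x v = constrain orth x v.
  rewrite /constrain (_ : cset free1 (x + v) = orth (x + v))//.
  apply/csetP/orthP => [h i|h i _]; last exact: h.
  by have [->|/h//] := eqVneq i ord0; rewrite cvD; lia.
have c1 : -1 <= constrain orth x v ord0 0.
  by rewrite /constrain; case: ifP => // _; rewrite mxE.
rewrite E; have [|-> h] := ih (x + constrain orth x v) sI' (step_cset v xO).
  by rewrite cvD; move: sx; rewrite intS; lia.
split => //; apply: le_trans h; rewrite cvD.
by move: sx; rewrite intS; lia.
Qed.

(** Each step changes the total by at most one, so no level is skipped. *)
Lemma tot_run_ivt S x s (n : int) : {subset s <= @increments d.+1} ->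
  n <= tot x -> tot (run S x s) <= n ->
  exists2 k, (k <= size s)%N & tot (run S x (take k s)) = n.
Proof.
elim: s x => [|v s ih] x sI nx /= xn; first by exists 0%N => //; lia.
have vI : v \in @increments d.+1 by apply: sI; rewrite mem_head.
have sI' : {subset s <= @increments d.+1}.
  by move=> u us; apply: sI; rewrite inE us orbT.
have [->|nx'] := eqVneq n (tot x); first by exists 0%N.
have [|k ks kn] := ih (x + constrain S x v) sI' _ xn.
  by have := step_tot S x vI; lia.
by exists k.+1.
Qed.
End Paths.

(** * Comparison of the two events *)

Section Limit.
Context (R : realType) (d : nat) (N : jackson_network R d.+1).
Context (disp : measure_display) (T : measurableType disp).
Context (P : probability T R) (I : nat -> T -> 'cV[int]_d.+1).
Hypothesis hI : iid_increments N P I.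
Implicit Types (x y : 'cV[int]_d.+1).

Local Notation pre := (history I).
Local Notation F := (cset (@free1 d)).

Definition overflow n x : set T := [set w | exists k,
  tot (run orth x (pre k w)) = n%:Z /\
  forall j, (j <= k)%N -> run orth x (pre j w) <> 0].

Definition hitsB y : set T :=
  [set w | exists k, boundaryB (walkY y (I^~ w) k)].

Definition hitsB_by K y : set T :=
  [set w | exists2 k, (k <= K)%N & boundaryB (walkY y (I^~ w) k)].

Lemma prob_overflowE n x : prob_overflow P I n x = P (overflow n x).
Proof.
congr (P _); apply/seteqP; split => w /=.
  move=> /hitting_time_ltP[k [kn k0]]; exists k.
  by rewrite -walk_run; split => // j /k0; rewrite -walk_run.
move=> [k [kn k0]]; apply/hitting_time_ltP; exists k; split.
  by rewrite -walk_run in kn.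
by move=> j /k0; rewrite -walk_run.
Qed.

Lemma prob_hitBE y : prob_hitB P I y = P (hitsB y).
Proof.
by congr (P _); apply/seteqP; split => w /= /hitting_time_finiteP.
Qed.

Lemma boundaryB_walkY n y w k : OmegaY y ->
  boundaryB (walkY y (I^~ w) k) <-> tot (run F (shift_map n y) (pre k w)) = n%:Z.
Proof.
move=> yO; rewrite (boundaryB_tot n) shift_walkY.
by split => [[]//|h]; split => //; exact: walkY_OmegaY.
Qed.

Lemma measurable_overflow n x : measurable (overflow n x).
Proof.
rewrite (_ : overflow n x = \bigcup_k [set w | tot (run orth x (pre k w)) = n%:Z /\
    forall j, (j <= k)%N -> run orth x (take j (pre k w)) <> 0]).
  apply: bigcupT_measurable => k; apply: (measurable_history hI k (fun s =>
    tot (run orth x s) = n%:Z /\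
    forall j, (j <= k)%N -> run orth x (take j s) <> 0)).
apply/seteqP; split => [w [k [kn k0]]|w [k _ [kn k0]]]; exists k => //.
  by split => // j jk; rewrite take_history//; exact: k0.
by split => // j jk; rewrite -(take_history I w jk); exact: k0.
Qed.

Lemma measurable_hitsB_by K y : OmegaY y -> measurable (hitsB_by K y).
Proof.
move=> yO; rewrite (_ : hitsB_by K y = [set w | exists2 k, (k <= K)%N &
    tot (run F (shift_map 0 y) (take k (pre K w))) = 0]).
  exact: (measurable_history hI K (fun s => exists2 k, (k <= K)%N &
    tot (run F (shift_map 0 y) (take k s)) = 0)).
apply/seteqP; split => w [k kK h]; exists k => //.
  by rewrite take_history//; exact/(boundaryB_walkY 0 w k yO).
by apply/(boundaryB_walkY 0 w k yO); move: h; rewrite take_history.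
Qed.

Lemma hitsB_bigcup y : hitsB y = \bigcup_K hitsB_by K y.
Proof.
apply/seteqP; split => w [k]; first by exists k => //; exists k.
by move=> _ [j _ h]; exists j.
Qed.

Lemma measurable_hitsB y : OmegaY y -> measurable (hitsB y).
Proof.
move=> yO; rewrite hitsB_bigcup; apply: bigcupT_measurable => K.
exact: measurable_hitsB_by.
Qed.

Lemma pre_increments w k : (forall j, I j w \in @increments d.+1) ->
  {subset pre k w <= @increments d.+1}.
Proof. by move=> wI v /mapP[j _ ->]. Qed.

Lemma orth_shift_map n y : OmegaY y -> y ord0 0 <= n%:Z -> orth (shift_map n y).
Proof.
move=> /csetP yO yn; apply/orthP => i; rewrite shift_mapE.
by have [_|i0] := eqVneq i ord0; [lia|exact: yO].
Qed.

(** For large [n] the first queue cannot empty before time [K], so that the two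
    walks agree and the origin is not visited. *)
Lemma hitsB_by_le_overflow K y n : OmegaY y ->
  (absz (y ord0 0%R) + K < n)%N ->
  (P (hitsB_by K y) <= P (overflow n (shift_map n y)))%E.
Proof.
move=> yO Kn; apply: (le_prob_increments hI).
- exact: measurable_hitsB_by.
- exact: measurable_overflow.
move=> w wI [k kK /(boundaryB_walkY n w k yO) kn].
have xO : orth (shift_map n y) by apply: orth_shift_map => //; lia.
have x0 : shift_map n y ord0 0 = n%:Z - y ord0 0 by rewrite shift_mapE eqxx.
exists k; split => [|j jk h].
  have [|-> _] := run_free1 (pre_increments (k := k) wI) xO; last by [].
  by rewrite size_history x0; lia.
have [|_] := run_free1 (pre_increments (k := j) wI) xO.
  by rewrite size_history x0; lia.
by rewrite h size_history x0 mxE; lia.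
Qed.

Section Stable.
Context (nu : 'I_d.+1 -> R) (hnu : traffic_solution N nu).
Context (hstable : forall i, nu i < service N i).

(** From beyond the boundary: the free walk has the smaller total of the two,
    and the constrained one empties. *)
Lemma prob_hitsB_beyond y n : OmegaY y -> y ord0 0 <= n%:Z ->
  n%:Z <= tot (shift_map n y) -> P (hitsB y) = 1%E.
Proof.
move=> yO yn ytot; set x := shift_map n y.
have xO : orth x by exact: orth_shift_map.
apply/eqP; rewrite eq_le probability_le1/=; last exact: measurable_hitsB.
apply/lee_addgt0Pr => e e0.
have [L [kappa [M0 [W [W0 flushW kappa0 few]]]]] :=
  flush_rate hnu hstable e0.
pose M := maxn M0 (kappa * (absz (tot x)).+1).
pose bad := [set w | (flushes L W M (pre (M * size W) w) * kappa < M)%N].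
have mbad : measurable bad.
  exact: (measurable_history hI _ (fun s => (flushes L W M s * kappa < M)%N)).
have Pbad : (P bad <= e%:E)%E.
  rewrite /bad (prob_history hI _ (fun s => (flushes L W M s * kappa < M)%N)).
  by rewrite lee_fin few// leq_maxl.
apply: (@le_trans _ _ (P (hitsB y) + P bad)%E); last by rewrite leeD2l.
apply: (@le_trans _ _ (P (hitsB y `|` bad))); last first.
  by apply: measureU2 => //; exact: measurable_hitsB.
rewrite -(probability_setT P); apply: (le_prob_increments hI) => //.
  by apply: measurableU => //; exact: measurable_hitsB.
move=> w wI _; have [wb|wb] := pselect (bad w); [by right|left].
have MV : (M <= flushes L W M (pre (M * size W) w) * kappa)%N.
  by rewrite leqNgt; apply/negP.
have preI := pre_increments (k := (M * size W)%N) wI.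
have [] := @run_flushed _ L W flushW M _ x (size_history _ _ _) preI xO.
  have : (kappa * (absz (tot x)).+1 <= M)%N by rewrite leq_maxr.
  move=> /leq_trans/(_ MV); rewrite mulnC leq_pmul2r//.
  by have := tot_ge0 xO; lia.
move=> k kM; rewrite take_history// => x0.
have preI' := pre_increments (k := k) wI.
have xxF : F (x - x) by apply/csetP => i _; rewrite subrr mxE.
have [_] := run_coupling (J := xpredT) (fun i _ => isT) preI' xO xxF.
rewrite subrr x0 subr0 tot0 => le0.
have [|j jk jn] := @tot_run_ivt _ F x (pre k w) n%:Z preI' ytot.
  exact: le_trans le0 _.
exists j; apply/(boundaryB_walkY n w j yO).
by rewrite -jn take_history// -(size_history I k w).
Qed.

(** Up to time [a = n - y 1], the initial length of the first queue, an overflow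
    of the constrained walk is one of the free walk.  Later it is unlikely: at
    least [Ln] of the initial customers have been flushed by then, while the walk
    started empty stays below [Ln] until time [H], by which the origin has been
    reached. *)
Lemma overflow_le_hitsB y (e : R) : OmegaY y -> tot (shift_map 0 y) < 0 -> 0 < e ->
  exists n0, forall n, (n0 <= n)%N ->
    (P (overflow n (shift_map n y)) <= P (hitsB y) + (e + e + e)%:E)%E.
Proof.
move=> yO ytot e0.
have [L [kappa [M0 [W [W0 flushW kappa0 few]]]]] :=
  flush_rate hnu hstable e0.
have [C [r [C0 r01 tail]]] := run0_tail hnu hstable.
have y_gt0 : 0 < y ord0 0.
  move: ytot; rewrite tot_shift_map sub0r addrC subr_lt0; apply: le_lt_trans.
  apply: sumr_ge0 => i i0; move/forallP : yO => /(_ i); by rewrite i0.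
set l := size W; set y0 := absz (y ord0 0%R).
(* [A * Ln.+1] will bound the horizon, which is linear in [n] *)
pose A := (kappa * l * (y0 + kappa * l)).+1.
have [n1 hn1] := linear_geometric_small r01 (mulr_ge0 C0 (ler0n _ A)) e0.
exists (y0 + l * kappa * n1 + l * M0 + M0).+1 => n nn.
pose a := (n - y0)%N; pose M1 := (a %/ l)%N; pose Ln := (M1 %/ kappa)%N.
pose M2 := (kappa * n)%N; pose H := (M2 * l)%N.
have Ln1 : (n1 <= Ln)%N.
  by rewrite /Ln /M1 -divnMA leq_divRL ?muln_gt0 ?W0// mulnC /a; lia.
have M1M : (M0 <= M1)%N by rewrite /M1 leq_divRL// mulnC /a; lia.
have M2M : (M0 <= M2)%N by rewrite /M2; nia.
have M1a : (M1 * l <= a)%N by exact: leq_divM.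
have aLn : (a < l * (kappa * Ln.+1))%N.
  have : (a < M1.+1 * l)%N by rewrite ltn_ceil.
  have : (M1 < Ln.+1 * kappa)%N by rewrite ltn_ceil.
  nia.
have HA : (H.+1 <= A * Ln.+1)%N.
  have : (n <= (y0 + kappa * l) * Ln.+1)%N by rewrite /a in aLn; nia.
  rewrite /H /M2 /A; set kl := (kappa * l)%N; rewrite mulnAC -/kl => h.
  by rewrite mulSn; nia.
set x := shift_map n y.
have yn : y ord0 0 <= n%:Z by lia.
have xO : orth x by exact: orth_shift_map.
have xn : tot x < n%:Z.
  by move: ytot; rewrite /x !tot_shift_map; lia.
have xa : x ord0 0 = a%:Z by rewrite /x shift_mapE eqxx; lia.
pose few_flushes M := [set w | (flushes L W M (pre (M * l) w) * kappa < M)%N].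
have mfew M : measurable (few_flushes M).
  exact: (measurable_history hI _ (fun s => (flushes L W M s * kappa < M)%N)).
have Pfew M : (M0 <= M)%N -> (P (few_flushes M) <= e%:E)%E.
  move=> MM; rewrite /few_flushes.
  rewrite (prob_history hI _ (fun s => (flushes L W M s * kappa < M)%N)).
  by rewrite lee_fin few.
pose Qhigh (s : seq 'cV[int]_d.+1) :=
  has (fun k => Ln%:Z <= tot (run orth 0 (take k s))) (iota 0 H.+1).
pose high := [set w | Qhigh (pre H w)].
have mhigh : measurable high by exact: (measurable_history hI _ Qhigh).
have Phigh : (P high <= e%:E)%E.
  rewrite /high (prob_history hI) lee_fin; apply: le_trans (hn1 _ Ln1).
  apply: le_trans (run0_max_tail H (fun k => tail k Ln)) _.
  rewrite mulrA ler_wpM2r//.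
    by rewrite exprn_ge0//; case/andP : r01 => /ltW.
  by rewrite -mulrA mulrC ler_wpM2l// -natrM ler_nat.
have mB := measurable_hitsB yO.
apply: (@le_trans _ _
    (P (hitsB y `|` (few_flushes M1 `|` few_flushes M2 `|` high)))).
  apply: (le_prob_increments hI); first exact: measurable_overflow.
    by do ?apply: measurableU.
  move=> w wI [k [kn k0]].
  have [/=|/= wg] := pselect ((few_flushes M1 `|` few_flushes M2 `|` high) w).
    by right.
  left; exists k; apply/(boundaryB_walkY n w k yO).
  have [ka|ka] := leqP k a.
    have [|<- _//] := run_free1 (pre_increments (k := k) wI) xO.
    by rewrite size_history xa lez_nat.
  exfalso.
  have V1 : (Ln <= flushes L W M1 (pre (M1 * l) w))%N.
    rewrite -(leq_pmul2r kappa0).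
    apply: (@leq_trans M1); first exact: leq_divM.
    by rewrite leqNgt; apply/negP => h; apply: wg; left; left.
  have V2 : (n <= flushes L W M2 (pre (M2 * l) w))%N.
    rewrite -(leq_pmul2r kappa0) [(n * _)%N]mulnC -/M2.
    by rewrite leqNgt; apply/negP => h; apply: wg; left; right.
  have kH : (k <= H)%N.
    have [] := @run_flushed _ L W flushW M2 _ x (size_history _ _ _)
      (pre_increments (k := (M2 * l)%N) wI) xO.
      by apply: lt_le_trans xn _; rewrite lez_nat.
    move=> j jH; rewrite take_history// => xj.
    rewrite leqNgt; apply/negP => Hk.
    by apply: (k0 j) xj; exact: leq_trans jH (ltnW Hk).
  have low_k : tot (run orth 0 (pre k w)) < Ln%:Z.
    rewrite ltNge; apply/negP => h; apply: wg; right; apply/hasP; exists k.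
      by rewrite mem_iota.
    by rewrite take_history.
  have [[j jM]|] := @run_flushes _ L W flushW M1 _ x (size_history _ _ _)
      (pre_increments (k := (M1 * l)%N) wI) xO.
    rewrite take_history//; apply: k0.
    exact: leq_trans (leq_trans jM M1a) (ltnW ka).
  have kE : pre k w = pre (M1 * l) w ++ drop (M1 * l) (pre k w).
    rewrite -{1}(cat_take_drop (M1 * l) (pre k w)) take_history//.
    exact: leq_trans M1a (ltnW ka).
  have dropI : {subset drop (M1 * l) (pre k w) <= @increments d.+1}.
    by move=> v /mem_drop; exact: pre_increments.
  have zO : orth (run orth 0 (pre (M1 * l) w)) by exact/run_cset/orth0.
  have xzO : orth (run orth x (pre (M1 * l) w) - run orth 0 (pre (M1 * l) w)).
    apply: (run_coupling (fun i h => h) _ (orth0 _) _).1; last by rewrite subr0.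
    exact: pre_increments.
  have [_] := run_coupling (fun i h => h) dropI zO xzO.
  rewrite -!run_cat -kE !totB kn -/l.
  by move: V1 low_k xn; clear; lia.
apply: (le_trans (measureU2 _ _ _)) => //; first by do ?apply: measurableU.
rewrite leeD2l//; apply: (le_trans (measureU2 _ _ _)) => //.
  exact: measurableU.
rewrite EFinD leeD// EFinD; apply: (le_trans (measureU2 _ _ _)) => //.
by rewrite leeD// Pfew.
Qed.

End Stable.
End Limit.

(** If the boundary is ever reached, then up to small probability it is reached
    by a fixed time. *)
Lemma hitsB_le_overflow (R : realType) (d : nat) (N : jackson_network R d.+1)
    (disp : measure_display) (T : measurableType disp) (P : probability T R)
    (I : nat -> T -> 'cV[int]_d.+1) (y : 'cV[int]_d.+1) (e : R) :
  iid_increments N P I -> OmegaY y -> 0 < e ->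
  exists n0, forall n, (n0 <= n)%N ->
    (P (hitsB I y) <= P (overflow I n (shift_map n y)) + e%:E)%E.
Proof.
move=> hI yO e0.
have mK K : measurable (hitsB_by I K y) by refine (measurable_hitsB_by hI K yO).
have mB := measurable_hitsB hI yO.
have : (P \o (fun K => hitsB_by I K y)) @ \oo --> P (hitsB I y).
  rewrite hitsB_bigcup; apply: nondecreasing_cvg_mu => //.
    by rewrite -hitsB_bigcup.
  move=> K K' KK; apply/subsetPset => w [k kK h].
  by exists k => //; exact: leq_trans kK KK.
rewrite -(fineK (fin_num_measure P _ mB)) => /fine_cvgP[_ /cvgrPdist_le/(_ _ e0)].
move=> [K _ /(_ K (leqnn K)) /=]; rewrite ler_distlC => /andP[PK _].
exists (absz (y ord0 0%R) + K).+1 => n Kn.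
have := hitsB_by_le_overflow hI yO Kn.
rewrite -(fineK (fin_num_measure P _ (mK K))) -(fineK (fin_num_measure P _ mB)).
rewrite -(fineK (fin_num_measure P _ (measurable_overflow hI n (shift_map n y)))).
by rewrite -EFinD !lee_fin; lra.
Qed.

Theorem proposition2p1 (R : realType) (d : nat) (N : jackson_network R d.+1)
  (nu : 'I_d.+1 -> R) (hnu : traffic_solution N nu)
  (hstable : forall i, nu i < service N i)
  (disp : measure_display) (T : measurableType disp) (P : probability T R)
  (I : nat -> T -> 'cV[int]_d.+1) (hI : iid_increments N P I)
  (y : 'cV[int]_d.+1) (hy : OmegaY y) :
  (fun n : nat => prob_overflow P I n (shift_map n y)) @ \oo --> prob_hitB P I y.
Proof.
rewrite prob_hitBE; under eq_fun do rewrite prob_overflowE.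
have mB := measurable_hitsB hI hy.
have mO n := measurable_overflow hI n (shift_map n y).
have upper (e : R) : 0 < e -> exists n0, forall n, (n0 <= n)%N ->
    (P (overflow I n (shift_map n y)) <= P (hitsB I y) + (e + e + e)%:E)%E.
  move=> e0; have [y0|y0] := ltP (tot (shift_map 0 y)) 0.
    by refine (overflow_le_hitsB hI hnu hstable hy y0 e0).
  exists 0%N => n _.
  rewrite (prob_hitsB_beyond hI hnu hstable (n := absz (y ord0 0%R)))//.
  - apply: (le_trans (probability_le1 P (mO n))).
    by rewrite leeDl// lee_fin !addr_ge0// ltW.
  - by lia.
  - by move: y0; rewrite !tot_shift_map; lia.
rewrite -(fineK (fin_num_measure P _ mB)); apply/fine_cvgP; split.
  by apply: nearW => n; exact: fin_num_measure.
apply/cvgrPdist_le => e e0.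
have e3 : 0 < e / 3 by lra.
have [n1 hn1] := hitsB_le_overflow hI hy e0.
have [n2 hn2] := upper _ e3.
exists (maxn n1 n2) => // n /=; rewrite geq_max => /andP[/hn1 h1 /hn2 h2].
move: h1 h2.
rewrite -(fineK (fin_num_measure P _ mB)) -(fineK (fin_num_measure P _ (mO n))).
rewrite -!EFinD !lee_fin => h1 h2; rewrite ler_norml; apply/andP; split; lra.
Qed.
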